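(* Let $\omega:[0,1]\to\mathbb{R}$ be a continuous nonconstant function, with associated tree $(\mathbb{T},\delta)$, length measure $\lambda$, and measures $\omega^\nearrow$, $\omega^\nwarrow$ on $[0,1]$ (defined in the context). The measures $\lambda$, $\omega^\nearrow$ and $\omega^\nwarrow$ are finite if and only if $\omega$ has finite variation. In this case, $\omega^\nearrow$ and $\omega^\nwarrow$ are respectively the positive and negative parts of the Lebesgue--Stieltjes measure $d\omega$ of $\omega$. Moreover, $$\int_0^1|d\omega|=2\,\lambda(\mathbb{T})-\delta(0,1),$$ where $\int_0^1|d\omega|$ is the total variation of $\omega$ on $[0,1]$.
   Context: For a continuous nonconstant $\omega:[0,1]\to\mathbb{R}$, put $\delta(s,t)=\omega(s)+\omega(t)-2\inf_{[s,t]}\omega$ ($[s,t]$ denotes the interval with endpoints $s,t$). This is a semi-distance on $[0,1]$; the quotient metric space $\mathbb{T}=([0,1]/\delta,\delta)$ is a compact real tree, i.e. any two points $\tau_1,\tau_2$ are joined by a unique arc $[\tau_1,\tau_2]$, which is isometric to $[0,\delta(\tau_1,\tau_2)]$. Let $\pi:[0,1]\to\mathbb{T}$ be the projection, and root $\mathbb{T}$ at $O=\pi(U)$, where $U$ is a time at which $\omega$ attains its minimum. A point $\tau_1$ is above $\tau_2$ if $\tau_2\in[O,\tau_1]$. A leaf is a point with no other point above it. The length measure $\lambda$ is the unique measure on $\mathbb{T}$ for which the set of leaves has measure zero and the measure of each arc is its length ($\lambda$ is $\sigma$-finite and atomless). $E^\nearrow$ (beginnings of excursions) is the set of $t\in[0,1)$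 such that for some $\varepsilon>0$, $\omega(s)>\omega(t)$ for $t<s<t+\varepsilon$; $E^\nwarrow$ (ends of excursions) is the set of $t\in(0,1]$ such that for some $\varepsilon>0$, $\omega(s)>\omega(t)$ for $t-\varepsilon<s<t$. For each level $x$ these sets intersected with $\{\omega=x\}$ are at most countable, and one defines measures on $[0,1]$ by $$\omega^\nearrow=\int_{\mathbb{R}}\sum_{s\in E^\nearrow,\ \omega(s)=x}\delta_s\,dx,\qquad \omega^\nwarrow=\int_{\mathbb{R}}\sum_{s\in E^\nwarrow,\ \omega(s)=x}\delta_s\,dx,$$ where $\delta_s$ is the Dirac mass at $s$. *)

(* Defs.v *)
From HB Require Import structures.
From mathcomp Require Import all_boot all_order all_algebra.
From mathcomp Require Import all_classical all_reals all_analysis.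
From mathcomp Require Import generic_quotient ring lra.

Set Implicit Arguments.
Unset Strict Implicit.
Unset Printing Implicit Defensive.
Import Order.TTheory GRing.Theory Num.Theory.
Import numFieldNormedType.Exports.

Local Open Scope classical_set_scope.
Local Open Scope quotient_scope.
Local Open Scope ring_scope.

Definition tree_delta {R : realType} (w : R -> R) (s t : R) : R :=
  w s + w t - 2 * inf (w @` `[Num.min s t, Num.max s t]).

Section semi_distance.
Context {R : realType} (w : R -> R).
Hypothesis w_cont : {within `[0, 1], continuous w}.

Local Notation m s t := (inf (w @` `[Num.min s t, Num.max s t])).

Lemma path_lbound : exists c, forall t, t \in `[0, 1] -> c <= w t.
Proof. by have [c _ h] := EVT_min ler01 w_cont; exists (w c). Qed.

Lemma path_inf_le s t u : s \in `[0, 1] -> t \in `[0, 1] ->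
  Num.min s t <= u <= Num.max s t -> m s t <= w u.
Proof.
rewrite !in_itv /= => /andP[s0 s1] /andP[t0 t1] hu.
have [c hc] := path_lbound; apply: ge_inf.
  exists c => _ [v /= + <-]; rewrite in_itv /= => /andP[v1 v2].
  apply: hc; rewrite in_itv /=; apply/andP; split.
    by apply: le_trans v1; rewrite le_min s0 t0.
  by apply: (le_trans v2); rewrite ge_max s1 t1.
by exists u => //=; rewrite in_itv.
Qed.

Lemma path_le_inf s t c :
  (forall u, Num.min s t <= u <= Num.max s t -> c <= w u) -> c <= m s t.
Proof.
move=> h; apply: lb_le_inf; last first.
  by move=> _ [u /= + <-]; rewrite in_itv /=; exact: h.
exists (w s); exists s => //=.
by rewrite in_itv /= ge_min lexx le_max lexx.
Qed.

Lemma min_max_l (s t : R) : Num.min s t <= s <= Num.max s t.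
Proof. by rewrite ge_min lexx le_max lexx. Qed.

Lemma min_max_r (s t : R) : Num.min s t <= t <= Num.max s t.
Proof. by rewrite ge_min lexx le_max lexx !orbT. Qed.

Lemma tree_deltaxx s : tree_delta w s s = 0.
Proof.
rewrite /tree_delta minxx maxxx set_itv1 image_set1 inf1.
by rewrite mulrDl mul1r subrr.
Qed.

Lemma tree_deltaC s t : tree_delta w s t = tree_delta w t s.
Proof. by rewrite /tree_delta minC maxC (addrC (w s)). Qed.

Lemma tree_delta_ge0 s t : s \in `[0, 1] -> t \in `[0, 1] ->
  0 <= tree_delta w s t.
Proof.
move=> hs ht; rewrite /tree_delta mulrDl mul1r subr_ge0.
apply: lerD; apply: path_inf_le => //.
- exact: min_max_l.
- exact: min_max_r.
Qed.

Lemma tree_delta_triangle t s u :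
  s \in `[0, 1] -> t \in `[0, 1] -> u \in `[0, 1] ->
  tree_delta w s u <= tree_delta w s t + tree_delta w t u.
Proof.
move=> hs ht hu.
have h1 : m s t <= w t by apply: path_inf_le => //; exact: min_max_r.
have h2 : m t u <= w t by apply: path_inf_le => //; exact: min_max_l.
have h3 : Num.min (m s t) (m t u) <= m s u.
  apply: path_le_inf => v hv; rewrite ge_min.
  have [|hst] := boolP (Num.min s t <= v <= Num.max s t).
    by move/(path_inf_le hs ht) => ->.
  apply/orP; right; apply: path_inf_le => //.
  move: hv hst; rewrite !ge_min !le_max.
  case: (leP v s); case: (leP v t); case: (leP v u);
    case: (leP s v); case: (leP t v); case: (leP u v) => //=;
    by move=> *; lra.
have h4 : m s t + m t u <= w t + m s u.
  move: h3; rewrite ge_min => /orP[h|h].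
    by rewrite addrC lerD.
  by rewrite lerD.
rewrite /tree_delta.
move: (m s t) (m t u) (m s u) h4 => a b c h4.
lra.
Qed.

End semi_distance.

Definition time (R : realType) := {t : R | t \in `[0, 1]}.

Section tree.
Context {R : realType} (w : R -> R).
Hypothesis w_cont : {within `[0, 1], continuous w}.
Implicit Types s t : time R.

Definition tree_rel s t := tree_delta w (val s) (val t) == 0.

Lemma tree_rel_refl : reflexive tree_rel.
Proof. by move=> s; rewrite /tree_rel tree_deltaxx. Qed.

Lemma tree_rel_sym : symmetric tree_rel.
Proof. by move=> s t; rewrite /tree_rel tree_deltaC. Qed.

Lemma tree_rel_trans : transitive tree_rel.
Proof.
move=> t s u /eqP h1 /eqP h2; rewrite /tree_rel eq_le.
rewrite (tree_delta_ge0 w_cont (valP s) (valP u)) andbT.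
have := tree_delta_triangle w_cont (valP s) (valP t) (valP u).
by rewrite h1 h2 addr0.
Qed.

Definition tree_equiv : equiv_rel (time R) :=
  EquivRel tree_rel tree_rel_refl tree_rel_sym tree_rel_trans.

Definition tree : Type := {eq_quot tree_equiv}.

HB.instance Definition _ := Choice.on tree.

Definition tree_pi (t : time R) : tree := \pi_({eq_quot tree_equiv}) t.

Definition tree_repr (x : tree) : time R := repr (x : {eq_quot tree_equiv}).

Definition tree_dist (x y : tree) : R :=
  tree_delta w (val (tree_repr x)) (val (tree_repr y)).

Lemma tree_reprK x : tree_pi (tree_repr x) = x.
Proof. exact: reprK. Qed.

Lemma tree_piE s t : tree_pi s = tree_pi t <-> tree_delta w (val s) (val t) = 0.
Proof.
split=> [/eqquotP /eqP //|h].
by apply/eqquotP; rewrite /= /tree_rel h.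
Qed.

Lemma tree_distE s t :
  tree_dist (tree_pi s) (tree_pi t) = tree_delta w (val s) (val t).
Proof.
have aux s' t' (u : time R) : tree_delta w (val s') (val t') = 0 ->
    tree_delta w (val s') (val u) = tree_delta w (val t') (val u).
  move=> h; apply/eqP; rewrite eq_le.
  have := tree_delta_triangle w_cont (valP s') (valP t') (valP u).
  have := tree_delta_triangle w_cont (valP t') (valP s') (valP u).
  by rewrite (tree_deltaC w (val t') (val s')) h !add0r => -> ->.
have hr (u : time R) : tree_delta w (val (tree_repr (tree_pi u))) (val u) = 0.
  by apply/tree_piE; rewrite tree_reprK.
by rewrite /tree_dist (aux _ _ _ (hr s)) tree_deltaC (aux _ _ _ (hr t)) tree_deltaC.
Qed.

Let tree_distxx x : tree_dist x x = 0.
Proof. exact: tree_deltaxx. Qed.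

Let tree_dist_eq0 x y : tree_dist x y = 0 -> x = y.
Proof. by move/tree_piE; rewrite !tree_reprK. Qed.

Let tree_distC x y : tree_dist x y = tree_dist y x.
Proof. exact: tree_deltaC. Qed.

Let tree_dist_triangle y x z : tree_dist x z <= tree_dist x y + tree_dist y z.
Proof. by apply: tree_delta_triangle => //; exact: valP. Qed.

HB.instance Definition _ := isMetric.Build R tree
  tree_distxx tree_dist_eq0 tree_distC tree_dist_triangle.

Lemma time0_subproof : (0 : R) \in `[0, 1].
Proof. by rewrite in_itv /= lexx ler01. Qed.

HB.instance Definition _ := isPointed.Build tree
  (tree_pi (exist _ 0 time0_subproof)).

Definition borel_tree := g_sigma_algebraType (@open tree).

End tree.

Section real_tree.
Context {R : realType} {T : metricType R}.

(* The parameter interval may be reduced to a point, so that {x} is the only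
   arc from x to x. *)
Definition is_arc (x y : T) (A : set T) :=
  exists (L : R) (g : R -> T),
    [/\ 0 <= L, {within `[0, L], continuous g}, {in `[0, L] &, injective g},
        g 0 = x /\ g L = y & A = g @` `[0, L]].

(* In a real tree there is exactly one A such that is_arc x y A. *)
Definition arc (x y : T) : set T := [set z | exists2 A, is_arc x y A & A z].

Definition above (O x y : T) := arc O x y.

Definition leaves (O : T) : set T :=
  [set x | forall y, above O y x -> y = x].

End real_tree.

Definition is_length_measure {R : realType} {w : R -> R}
    {w_cont : {within `[0, 1], continuous w}} (O : tree w_cont)
    (lambda : {measure set (borel_tree w_cont) -> \bar R}) :=
  lambda (leaves O) = 0%E /\
  forall x y : tree w_cont, lambda (arc x y) = (mdist x y)%:E.

Definition excursion_begin {R : realType} (w : R -> R) : set R :=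
  [set t | 0 <= t < 1 /\ exists2 e, 0 < e &
     forall s, s \in `[0, 1] -> t < s < t + e -> w t < w s].

Definition excursion_end {R : realType} (w : R -> R) : set R :=
  [set t | 0 < t <= 1 /\ exists2 e, 0 < e &
     forall s, s \in `[0, 1] -> t - e < s < t -> w t < w s].

(* Total set functions: countable additivity, and measurability of the level
   counts under the integral, are only to be expected on Borel sets A. *)
Definition omega_up {R : realType} (w : R -> R) (A : set (measurableTypeR R)) :
    \bar R :=
  (\int[lebesgue_measure]_x
     \esum_(s in [set s | excursion_begin w s /\ w s = x]) \d_s A)%E.

Definition omega_down {R : realType} (w : R -> R) (A : set (measurableTypeR R)) :
    \bar R :=
  (\int[lebesgue_measure]_x
     \esum_(s in [set s | excursion_end w s /\ w s = x]) \d_s A)%E.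

(* The measure d omega, seen as a signed Borel measure on R carried by [0, 1];
   it has no mass at 0 because omega is continuous. *)
Definition is_lebesgue_stieltjes {R : realType} (w : R -> R)
    (nu : {charge set (measurableTypeR R) -> \bar R}) :=
  [/\ forall a b, 0 <= a -> a <= b -> b <= 1 ->
        nu [set` `]a, b]%R] = (w b - w a)%:E,
      nu [set 0] = 0%E &
      forall A : set (measurableTypeR R), measurable A ->
        A `&` [set` `[0, 1]%R] = set0 -> nu A = 0%E].

(* Main.v *)
(* For a partition t_0 < ... < t_n, put
     S = sum_i (w(t_i) - inf_[t_(i-1), t_i] w).
   Comparing increments, and refining by points where the infima are attained,
   shows that the supremum of 2 S over the partitions of [a, b] is
   TV(a, b) + w(b) - w(a).  Three masses are governed by S:
   - exploring the tree from left to right, the point of t_i adds to the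
     subtree spanned by the root and t_0, ..., t_(i-1) a branch of length
     w(t_i) - inf_[t_(i-1), t_i] w, so this subtree has length
     w(t_0) - min w + S; along dyadic partitions these subtrees exhaust the
     complement of the leaves;
   - at level x, the interval [t_(i-1), t_i] contributes to S the indicator of
     inf w <= x < w(t_i); the last passage at x is then the beginning of an
     excursion, and along dyadic partitions all beginnings of excursions at
     level x are captured, so that by Fatou's lemma the mass of the beginnings
     of excursions is sup S;
   - ends of excursions are beginnings of excursions of t |-> w(-t).
   When w has finite variation, d w is therefore the difference of the two
   excursion measures, whose total masses add up to TV; any such decomposition
   dominates the Jordan decomposition, and equality of masses forces equality
   of measures. *)
Require Import Defs.
From HB Require Import structures.
From mathcomp Require Import all_boot all_order all_algebra finmap.
From mathcomp Require Import all_classical all_reals all_analysis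
  measurable_realfun.
From mathcomp Require Import ring lra.

Set Implicit Arguments.
Unset Strict Implicit.
Unset Printing Implicit Defensive.
Import Order.TTheory GRing.Theory Num.Theory.
Import numFieldNormedType.Exports.

Local Open Scope classical_set_scope.
Local Open Scope ring_scope.

(** * Path infima and last passage times *)

Section path_infimum.
Context {R : realType} (w : R -> R) (A B : R).
Hypothesis w_cont : {within `[A, B], continuous w}.

(** The path infimum of [tree_delta], with the endpoints in either order. The ambient interval
    [A, B] stays a parameter because the results also serve the reversed path on [-1, 0]. *)
Definition pinf (s t : R) : R := inf (w @` `[Num.min s t, Num.max s t]).

Lemma within_continuous_dist (s e : R) : A <= s <= B -> 0 < e ->
  exists2 d, 0 < d &
    forall r, A <= r <= B -> `|r - s| < d -> `|w r - w s| < e.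
Proof.
move=> sAB e0; have sI : `[A, B]%classic s by rewrite /= in_itv.
have /subspace_continuousP/(_ _ sI)/cvgrPdist_lt/(_ _ e0) := w_cont.
move=> /nbhs_ballP[d /= d0 h]; exists d => // r rAB rs.
rewrite distrC; apply: h; last by rewrite /= in_itv.
by rewrite /ball /= distrC.
Qed.

Lemma pinf_attained (s t : R) : A <= s <= B -> A <= t <= B ->
  exists2 r, Num.min s t <= r <= Num.max s t &
    pinf s t = w r /\
    forall u, Num.min s t <= u <= Num.max s t -> w r <= w u.
Proof.
move=> /andP[s0 s1] /andP[t0 t1].
have mM : Num.min s t <= Num.max s t by rewrite ge_min le_max lexx.
have [|c cst hc] := @EVT_min _ w _ _ mM.
  apply: continuous_subspaceW w_cont => x /=; rewrite !in_itv /= ge_min le_max.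
  by move=> /andP[]; case/orP => ? /orP[] ?; apply/andP; split; lra.
have h u : Num.min s t <= u <= Num.max s t -> w c <= w u.
  by move=> hu; apply: hc; rewrite in_itv.
exists c; first by rewrite in_itv in cst.
split=> //; apply/eqP; rewrite eq_le (path_le_inf h) andbT.
by apply: ge_inf; [exists (w c) => _ [v /= + <-]; exact: hc|exists c].
Qed.

Lemma pinf_le s t r : A <= s <= B -> A <= t <= B ->
  Num.min s t <= r <= Num.max s t -> pinf s t <= w r.
Proof. by move=> hs ht hr; have [c _ [-> ]] := pinf_attained hs ht; exact. Qed.

Lemma le_pinf s t c :
  (forall u, Num.min s t <= u <= Num.max s t -> c <= w u) -> c <= pinf s t.
Proof. exact: path_le_inf. Qed.

Lemma pinfC s t : pinf s t = pinf t s.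
Proof. by rewrite /pinf minC maxC. Qed.

Lemma pinf_lel s t : A <= s <= B -> A <= t <= B -> pinf s t <= w s.
Proof. by move=> hs ht; apply: pinf_le => //; exact: min_max_l. Qed.

Lemma pinf_ler s t : A <= s <= B -> A <= t <= B -> pinf s t <= w t.
Proof. by move=> hs ht; apply: pinf_le => //; exact: min_max_r. Qed.

Lemma le_pinf_le s t c : s <= t ->
  (forall u, s <= u <= t -> c <= w u) -> c <= pinf s t.
Proof. by move=> st h; apply: le_pinf; rewrite min_l // max_r. Qed.

(** Every time between [s] and [u] lies between [s] and [t] or between [t] and [u]. This ultrametric
    inequality carries most of the tree geometry below. *)
Lemma pinf_min t s u : A <= s <= B -> A <= t <= B -> A <= u <= B ->
  Num.min (pinf s t) (pinf t u) <= pinf s u.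
Proof.
move=> hs ht hu; apply: le_pinf => v hv; rewrite ge_min.
have [|hst] := boolP (Num.min s t <= v <= Num.max s t).
  by move/(pinf_le hs ht) => ->.
apply/orP; right; apply: pinf_le => //.
move: hv hst; rewrite !ge_min !le_max.
case: (leP v s); case: (leP v t); case: (leP v u);
  case: (leP s v); case: (leP t v); case: (leP u v) => //=;
  by move=> *; lra.
Qed.

(* [u] itself is included so that the supremum is monotone in [x] on all of
   [R], in particular for the levels below the infimum on [u, v]. *)
Definition last_passage (u v x : R) : R :=
  sup [set r | u <= r <= v /\ (r = u \/ w r <= x)].

(** Monotonicity in the level is what makes [last_passage] Borel measurable later on. *)
Lemma last_passage_homo u v : {homo last_passage u v : x y / x <= y}.
Proof.
move=> x y xy; have [uv|vu] := leP u v; last first.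
  have S0 z : [set r | u <= r <= v /\ (r = u \/ w r <= z)] = set0.
    by apply/seteqP; split => // r [/andP[h1 h2] _]; lra.
  by rewrite /last_passage !S0.
apply: le_sup.
- move=> r /= [urv h]; exists r; split => //=; split => //.
  by case: h => [->|h]; [left|right; exact: le_trans xy].
- by exists u => /=; split; [rewrite lexx|left].
- split; first by exists u => /=; split; [rewrite lexx|left].
  by exists v => r /= [/andP[]].
Qed.

Lemma last_passageP u v x r0 : A <= u -> v <= B ->
  u <= r0 <= v -> w r0 <= x -> x <= w v ->
  [/\ u <= last_passage u v x <= v, w (last_passage u v x) = x &
      forall r, last_passage u v x < r <= v -> x < w r].
Proof.
move=> Au vB /andP[ur0 r0v] wr0 xv; set s := last_passage u v x.
pose S := [set r | u <= r <= v /\ (r = u \/ w r <= x)].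
have uv : u <= v by lra.
have Su : S u by split; [rewrite lexx|left].
have Sub : has_sup S by split; [exists u|exists v => r [/andP[]]].
have Sle r : S r -> r <= s by move=> Sr; exact: ub_le_sup Sub.2 _ Sr.
have us : u <= s by exact: Sle.
have sv : s <= v by apply: ge_sup; [exists u|move=> r [/andP[]]].
have sAB : A <= s <= B by apply/andP; split; lra.
have gt_x r : s < r <= v -> x < w r.
  move=> /andP[sr rv]; rewrite ltNge; apply/negP => wr.
  have : r <= s by apply: Sle; split; [apply/andP; split; lra|right].
  by lra.
split=> //; first exact/andP.
apply/eqP; rewrite eq_le; apply/andP; split; rewrite leNgt; apply/negP => ws.
(* If [w s] exceeded [x], the path would stay above [x] on ]s - d, s], which contains an element [r]
   of the set. Either [w r <= x], or [r = u] and then [r0] lies in that interval; both are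
   absurd. *)
- have [|d d0 hd] := @within_continuous_dist s (w s - x) sAB; first by lra.
  have gtd r : s - d < r <= s -> u <= r -> x < w r.
    move=> /andP[dr rs] ur; have : `|w r - w s| < w s - x.
      by apply: hd; [apply/andP; split; lra|rewrite ltr_distl; apply/andP;
        split; lra].
    by rewrite ltr_distl => /andP[]; lra.
  have [r Sr dr] := sup_adherent d0 Sub.
  have rs := Sle _ Sr; case: (Sr) => /andP[ur _] [ru|wr].
  + have r0s : r0 <= s by apply: Sle; split; [apply/andP|right].
    have : x < w r0 by apply: gtd => //; apply/andP; split => //;
      apply: lt_le_trans ur0; rewrite -ru.
    by lra.
  + have : x < w r by apply: gtd => //; apply/andP.
    by lra.
(* If [w s] were below [x], the path would take the value [x] on [s, v], hence at [s] itself, since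
   it exceeds [x] after [s]. *)
- have [||r] := @IVT _ w s v x sv.
  + apply: continuous_subspaceW w_cont => z /=; rewrite !in_itv /=.
    by move=> /andP[? ?]; apply/andP; split; lra.
  + by rewrite ge_min le_max (ltW ws) xv orbT.
  rewrite in_itv /= => /andP[sr rv] wr.
  have [sltr|srr] := ltP s r.
    have : x < w r by apply: gt_x; apply/andP.
    by lra.
  have rs : r = s by lra.
  by move: wr; rewrite rs; lra.
Qed.

End path_infimum.

(** * Partitions *)

Section partition.
Context {R : realType}.
Implicit Types (a b : R) (s : seq R).

Definition steps a s : seq (R * R) := zip (a :: s) s.

Lemma steps_cons a y s : steps a (y :: s) = (a, y) :: steps y s.
Proof. by []. Qed.

Lemma itv_partition_consP a b y s :
  itv_partition a b (y :: s) <-> a < y /\ itv_partition y b s.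
Proof.
split=> [[/= /andP[ay ys] l]|[ay [ys l]]]; first by split.
by split => //=; rewrite ay.
Qed.

Lemma itv_partition_ind (P : R -> R -> seq R -> Prop) :
  (forall b, P b b [::]) ->
  (forall a y b s, a < y -> y <= b -> itv_partition y b s -> P y b s ->
     P a b (y :: s)) ->
  forall a b s, itv_partition a b s -> P a b s.
Proof.
move=> P0 PS a b s; elim: s a => [|y s ih] a.
  by move=> /itv_partition_nil ->; exact: P0.
move=> /itv_partition_consP[ay ps]; apply: PS => //; last exact: ih.
exact: itv_partition_le ps.
Qed.

Lemma steps_itv a b s : itv_partition a b s ->
  forall p, p \in steps a s -> [/\ a <= p.1, p.1 < p.2 & p.2 <= b].
Proof.
elim/itv_partition_ind => // {}a y {}b {}s ay yb ps ih p.
rewrite steps_cons inE => /predU1P[->|/ih[h1 h2 h3]] //=.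
by split => //; rewrite (le_trans _ h1) // ltW.
Qed.

(** An [itv_partition] does not list its left endpoint, so the indices start at 1. *)
Definition dyadic a b n : seq R :=
  [seq a + (b - a) / 2 ^+ n * k%:R | k <- iota 1 (2 ^ n)].

Let path_arith a h m N : 0 < h ->
  path <%R (a + h * m%:R) [seq a + h * k%:R | k <- iota m.+1 N].
Proof.
move=> h0; elim: N m => //= N ih m; rewrite ih andbT.
by rewrite ltrD2l ltr_pM2l // ltr_nat.
Qed.

Let last_arith a h m N :
  last (a + h * m%:R) [seq a + h * k%:R | k <- iota m.+1 N] =
  a + h * (m + N)%:R.
Proof.
by elim: N m => [|N ih] m /=; rewrite ?addn0 // ih addSnnS.
Qed.

Lemma dyadic_partition a b n : a < b -> itv_partition a b (dyadic a b n).
Proof.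
move=> ab; have h0 : 0 < (b - a) / 2 ^+ n.
  by rewrite divr_gt0 ?exprn_gt0 // subr_gt0.
have := path_arith a 0 (2 ^ n) h0;
  have := last_arith a ((b - a) / 2 ^+ n) 0 (2 ^ n).
rewrite mulr0 addr0 add0n natrX divfK ?expf_neq0 // => hl hp.
by split=> //; apply/eqP; rewrite hl addrC subrK.
Qed.

Let mesh_arith a h m N p :
  p \in steps (a + h * m%:R) [seq a + h * k%:R | k <- iota m.+1 N] ->
  p.2 = p.1 + h.
Proof.
elim: N m => [|N ih] m; first by rewrite /steps /= in_nil.
rewrite steps_cons inE => /predU1P[-> /=|]; last exact: ih.
by rewrite -addrA -natr1 mulrDr mulr1.
Qed.

Lemma dyadic_mesh a b n p : p \in steps a (dyadic a b n) ->
  p.2 = p.1 + (b - a) / 2 ^+ n.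
Proof.
move=> hp; apply: (@mesh_arith a _ 0 (2 ^ n)); by rewrite mulr0 addr0.
Qed.

Lemma dyadic_mesh_cvg a b :
  (b - a) / 2 ^+ n @[n --> \oo] --> (0 : R).
Proof.
have := @cvg_geometric R (b - a) (2^-1).
rewrite ger0_norm; last by rewrite invr_ge0.
rewrite invf_lt1 // ltr1n => /(_ isT).
rewrite (_ : geometric _ _ = fun n => (b - a) / 2 ^+ n) //.
by apply/funext => n; rewrite /geometric /= exprVn.
Qed.

End partition.

(** * Sums of rises above the path infimum *)

Section upsum.
Context {R : realType} (w : R -> R) (A B : R).
Hypothesis w_cont : {within `[A, B], continuous w}.

Definition upsum (a : R) (s : seq R) : R :=
  \sum_(p <- steps a s) (w p.2 - pinf w p.1 p.2).

(** On each step, |d| + d is twice the positive part of the increment d, and this positive part is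
    at most [w y - pinf w a y]. *)
Lemma variation_le_upsum a b s : A <= a -> b <= B -> itv_partition a b s ->
  variation a b w s + (w b - w a) <= 2 * upsum a s.
Proof.
move=> + + ps; rewrite (variation_zip _ ps) /upsum.
elim/(@itv_partition_ind R): ps => [{}b _ _|{}a y {}b {}s ay yb ps ih Aa bB].
  by rewrite !big_nil subrr addr0 mulr0.
rewrite steps_cons /= !big_cons /=.
have ha : A <= a <= B by apply/andP; split; lra.
have hy : A <= y <= B by apply/andP; split; lra.
have h1 := pinf_lel w_cont ha hy; have h2 := pinf_ler w_cont ha hy.
have := ih _ bB; rewrite (_ : A <= y); last by lra.
move=> /(_ isT) {ih}.
have : `|w y - w a| + (w y - w a) <= 2 * (w y - pinf w a y).
  by case: (ler0P (w y - w a)); lra.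
move: (\sum_(_ <- _) _) (\sum_(_ <- _) _) => S1 S2; lra.
Qed.

(** Each step is refined at a time [r] where its infimum is attained. The drop to [r] and the rise
    from [r] add up to [w a + w y - 2 * w r]; adding [w y - w a] gives twice [w y - w r]. *)
Lemma upsum_le_total_variation a b s : A <= a -> b <= B ->
  itv_partition a b s ->
  ((2 * upsum a s)%:E <= total_variation a b w + (w b - w a)%:E)%E.
Proof.
move=> + + ps; rewrite /upsum.
elim/(@itv_partition_ind R): ps => [{}b _ _|{}a y {}b {}s ay yb ps ih Aa bB].
  by rewrite !big_nil subrr mulr0 total_variationxx adde0.
rewrite steps_cons /= !big_cons /=.
have ha : A <= a <= B by apply/andP; split; lra.
have hy : A <= y <= B by apply/andP; split; lra.
have Ay : A <= y by lra.
rewrite mulrDr EFinD (total_variationD w (ltW ay) yb).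
have -> : (w b - w a)%:E = ((w y - w a)%:E + (w b - w y)%:E)%E.
  by rewrite -EFinD; congr EFin; ring.
rewrite addeACA; apply: leeD; last exact: ih.
have [r + [-> _]] := pinf_attained w_cont ha hy.
rewrite (min_l (ltW ay)) (max_r (ltW ay)) => /andP[ar ry].
rewrite (total_variationD w ar ry).
apply: le_trans (leeD (leeD (total_variation_ge w ar)
  (total_variation_ge w ry)) (lexx _)).
rewrite -!EFinD lee_fin.
have := ler_norm (- (w r - w a)); rewrite normrN.
have := ler_norm (w y - w r); lra.
Qed.

End upsum.

(** * Counting beginnings of excursions at a level *)

(** The sequence is squeezed between its tail infima, which converge to the supremum, and the
    supremum itself. The use is with [S] the finite partial sums of an [esum]. *)
Lemma cvg_ereal_sup {R : realType} (u : (\bar R)^nat) (S : set (\bar R)) :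
  (forall n, u n <= ereal_sup S)%E ->
  (forall y, S y -> \forall n \near \oo, (y <= u n)%E) ->
  u n @[n --> \oo] --> ereal_sup S.
Proof.
move=> uS Su; apply: (@squeeze_cvge _ _ _ _ (einfs u) _ (cst (ereal_sup S))).
- apply: nearW => n; rewrite uS andbT.
  by apply: ereal_inf_lbound; exists n => /=.
- suff -> : ereal_sup S = ereal_sup (range (einfs u)) by exact: cvg_einfs_sup.
  apply/eqP; rewrite eq_le; apply/andP; split; apply: ge_ereal_sup.
  + move=> y /Su[N _ hN]; apply: (@le_trans _ _ (einfs u N)).
      by apply: le_ereal_inf_tmp => _ [n /= Nn <-]; exact: hN.
    by apply: ereal_sup_ubound; exists N.
  + move=> _ [n _ <-]; apply: le_trans (uS n).
    by apply: ereal_inf_lbound; exists n => /=.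
- exact: cvg_cst.
Qed.

Section level_counts.
Context {R : realType} (w : R -> R).
Implicit Types (a b x : R) (D : set (measurableTypeR R)).

(** Beginnings of excursions seen inside [a, b]. Keeping the witness [v] in the interval makes the
    notion additive when the interval is cut. *)
Definition up_set a b x : set R :=
  [set s | [/\ a <= s < b,
    (exists2 v, s < v <= b & forall u, s < u <= v -> w s < w u) & w s = x]].

Definition upcount a b D x : \bar R := \esum_(s in up_set a b x) \d_s D.

(** Beginnings of excursions that last for time [h], or until [b]. A step of length at most [h]
    contains at most one of them at a given level, so they can be counted step by step. *)
Definition up_set_within h a b x : set R :=
  [set s | [/\ a <= s < b,
    (forall u, s < u <= b -> u <= s + h -> w s < w u) & w s = x]].

Lemma dirac_ge0 (s : R) D : (0 <= \d_s D :> \bar R)%E.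
Proof. by rewrite diracE lee_fin ler0n. Qed.

Lemma esum_dirac_ge0 (I : set R) D : (0 <= \esum_(s in I) \d_s D :> \bar R)%E.
Proof. by apply: esum_ge0 => s _; exact: dirac_ge0. Qed.

Lemma subset_esum_dirac (I J : set R) D : I `<=` J ->
  (\esum_(s in I) \d_s D <= \esum_(s in J) \d_s D :> \bar R)%E.
Proof.
move=> IJ; rewrite (@esumID _ _ I J); last by move=> ? _; exact: dirac_ge0.
by rewrite (setIidr IJ) leeDl // esum_dirac_ge0.
Qed.

Lemma up_setE a y b x : a <= y -> y <= b ->
  up_set a b x `&` [set s | s < y] = up_set a y x /\
  up_set a b x `&` ~` [set s | s < y] = up_set y b x.
Proof.
move=> ay yb; split; apply/seteqP; split => s.
- move=> [[/andP[as_ sb] [v /andP[sv vb] hv] ws] /= sy].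
  split => //; first exact/andP.
  exists (Num.min v y); first by rewrite lt_min sv sy ge_min lexx orbT.
  by move=> u; rewrite le_min => /andP[su /andP[uv _]]; apply: hv; exact/andP.
- move=> [/andP[as_ sy] [v /andP[sv vb] hv] ws]; split => //; split => //.
    by apply/andP; split => //; lra.
  by exists v => //; apply/andP; split => //; lra.
- move=> [[/andP[as_ sb] [v /andP[sv vb] hv] ws] /= /negP].
  rewrite -leNgt => ys; split => //; first exact/andP.
  by exists v => //; exact/andP.
- move=> [/andP[ys sb] h ws]; split.
    by split => //; apply/andP; split => //; lra.
  by apply/negP; rewrite -leNgt.
Qed.

Lemma upcountD a y b D x : a <= y -> y <= b ->
  upcount a b D x = (upcount a y D x + upcount y b D x)%E.
Proof.
move=> ay yb; rewrite /upcount; have [<- <-] := @up_setE a y b x ay yb.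
by apply: esumID => s _; exact: dirac_ge0.
Qed.

Lemma up_setxx a x : up_set a a x = set0.
Proof.
by apply/seteqP; split => // s [/andP[h1 h2]]; have := le_lt_trans h1 h2;
  rewrite ltxx.
Qed.

Lemma upcount_xx a D x : upcount a a D x = 0%E.
Proof. by rewrite /upcount up_setxx esum_set0. Qed.

(** Only an inequality: once the path is cut at [y], an excursion started before [y] is no longer
    required to last beyond [y]. *)
Lemma esum_withinD h a y b D x : a <= y -> y <= b ->
  (\esum_(s in up_set_within h a b x) \d_s D <=
   \esum_(s in up_set_within h a y x) \d_s D +
   \esum_(s in up_set_within h y b x) \d_s D :> \bar R)%E.
Proof.
move=> ay yb; rewrite (@esumID _ _ [set s | s < y]); last first.
  by move=> ? _; exact: dirac_ge0.
apply: leeD; apply: subset_esum_dirac => s.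
- move=> [[/andP[as_ sb] hv ws] /= sy]; split => //; first exact/andP.
  by move=> u /andP[su uy]; apply: hv; apply/andP; split => //; lra.
- move=> [[/andP[as_ sb] hv ws] /= /negP]; rewrite -leNgt => ys.
  by split => //; exact/andP.
Qed.

(** Each point of [F] begins an excursion of some positive duration [v - s], and finitely many
    durations all exceed [h n] for large [n]. *)
Lemma finite_up_set_within (h : nat -> R) (F : set R) a b x :
  h n @[n --> \oo] --> (0 : R) -> finite_set F -> F `<=` up_set a b x ->
  \forall n \near \oo, F `<=` up_set_within (h n) a b x.
Proof.
move=> h0 /finite_fsetP[G ->] FU.
have : \forall n \near \oo,
    (\bigcap_(s in [set` G]) [set n | up_set_within (h n) a b x s]) n.
  apply: filter_bigI => s sG.
  have [ab [v /andP[sv vb] hv] ws] := FU s sG.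
  have : \forall n \near \oo, h n < v - s.
    by apply: (cvgr_lt 0) => //; rewrite subr_gt0.
  apply: filterS => n hn; split => // u /andP[su ub] ush.
  by apply: hv; apply/andP; split => //; lra.
by apply: filterS => n hn s sG; exact: hn.
Qed.

Variables (A B : R).
Hypothesis w_cont : {within `[A, B], continuous w}.

(** The level [w v] is excluded because its last passage is [v], which begins no excursion inside
    [u, v]. With [D = setT], the Lebesgue measure of this set is one term of [upsum]. *)
Definition up_levels D u v : set R :=
  `[pinf w u v, w v[ `&` last_passage w u v @^-1` D.

Lemma up_levels_upcount D u v x : A <= u -> u < v -> v <= B ->
  ((\1_(up_levels D u v) x)%:E <= upcount u v D x)%E.
Proof.
move=> Au uv vB; rewrite indicE.
have [|_] := boolP (x \in up_levels D u v); last exact: esum_dirac_ge0.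
rewrite inE => -[]; rewrite /= in_itv /= => /andP[mx xv] TD.
have hu : A <= u <= B by apply/andP; split; lra.
have hv : A <= v <= B by apply/andP; split; lra.
have [r + [mr _]] := pinf_attained w_cont hu hv.
rewrite (min_l (ltW uv)) (max_r (ltW uv)) => urv.
have := last_passageP w_cont Au vB urv _ (ltW xv).
rewrite -mr => /(_ mx); set T := last_passage _ _ _ _ => -[/andP[uT Tv] wT hT].
have TU : up_set u v x T.
  have {}Tv : T < v by rewrite lt_neqAle Tv andbT;
    apply: contraTN xv => /eqP <-; rewrite wT ltxx.
  split => //; first exact/andP.
  by exists v; [rewrite Tv lexx|rewrite wT].
apply: le_trans (@subset_esum_dirac [set T] _ _ _); last by move=> _ ->.
by rewrite esum_set1 ?dirac_ge0 // diracE mem_set.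
Qed.

(** In so short a step, the path cannot come back to [x] after a point of [up_set_within], so the
    only candidate is the last passage at [x]. *)
Lemma esum_within_up_levels h D u v x : A <= u -> u < v -> v <= B ->
  v <= u + h ->
  (\esum_(s in up_set_within h u v x) \d_s D <= (\1_(up_levels D u v) x)%:E
    :> \bar R)%E.
Proof.
move=> Au uv vB vuh; set T := last_passage w u v x.
have hu : A <= u <= B by apply/andP; split; lra.
have hv : A <= v <= B by apply/andP; split; lra.
have key s : up_set_within h u v x s -> pinf w u v <= x < w v /\ s = T.
  move=> [/andP[us sv] hs ws].
  have mx : pinf w u v <= x.
    by rewrite -ws; apply: (pinf_le w_cont) => //;
      rewrite (min_l (ltW uv)) (max_r (ltW uv)) us ltW.
  have {}hs r : s < r <= v -> x < w r.
    by move=> /andP[sr rv]; rewrite -ws; apply: hs; [exact/andP|lra].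
  have xv : x < w v by apply: hs; rewrite sv lexx.
  have usv : u <= s <= v by rewrite us ltW.
  have wsx : w s <= x by rewrite ws.
  have [/andP[uT Tv] wT hT] := last_passageP w_cont Au vB usv wsx (ltW xv).
  split; first exact/andP.
  apply/eqP; rewrite eq_le; apply/andP; split; rewrite leNgt; apply/negP => h1.
  - by have := hT s; rewrite -/T h1 ltW // => /(_ isT); rewrite ws ltxx.
  - by have := hs T; rewrite h1 Tv => /(_ isT); rewrite wT ltxx.
have [->|/set0P[s Us]] := eqVneq (up_set_within h u v x) set0.
  by rewrite esum_set0 lee_fin indicE ler0n.
have [mx sT] := key s Us.
apply: le_trans (@subset_esum_dirac _ [set T] _ _) _; first by move=> r /key[].
rewrite esum_set1 ?dirac_ge0 // diracE indicE lee_fin ler_nat.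
have [TD|] := boolP (T \in D); last by [].
by rewrite mem_set //; split; [rewrite /= in_itv|move: TD; rewrite inE].
Qed.

Definition partition_count D a (s : seq R) x : \bar R :=
  (\sum_(p <- steps a s) (\1_(up_levels D p.1 p.2) x)%:E)%E.

Lemma partition_count_le D a b s x : A <= a -> b <= B ->
  itv_partition a b s -> (partition_count D a s x <= upcount a b D x)%E.
Proof.
move=> + + ps; rewrite /partition_count.
elim/(@itv_partition_ind R): ps => [{}b _ _|{}a y {}b {}s ay yb ps ih Aa bB].
  by rewrite big_nil upcount_xx.
rewrite steps_cons big_cons /= (upcountD _ _ (ltW ay) yb).
apply: leeD; first by apply: up_levels_upcount => //; lra.
by apply: ih => //; lra.
Qed.

Lemma esum_within_le h D a b s x : A <= a -> b <= B ->
  itv_partition a b s -> {in steps a s, forall p, p.2 <= p.1 + h} ->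
  (\esum_(s in up_set_within h a b x) \d_s D <= partition_count D a s x
    :> \bar R)%E.
Proof.
move=> + + ps; rewrite /partition_count.
elim/(@itv_partition_ind R): ps => [{}b _ _|{}a y {}b {}s ay yb ps ih Aa bB] hs.
  rewrite big_nil (_ : up_set_within _ _ _ _ = set0) ?esum_set0 //.
  apply/seteqP; split => // r [/andP[h1 h2]].
  by have := le_lt_trans h1 h2; rewrite ltxx.
rewrite steps_cons big_cons /=.
apply: le_trans (esum_withinD _ _ _ (ltW ay) yb) _.
apply: leeD.
  apply: esum_within_up_levels => //; first by lra.
  by have := hs (a, y); rewrite steps_cons inE eqxx => /(_ isT).
apply: ih => //; first by lra.
by move=> p ps'; apply: hs; rewrite steps_cons inE ps' orbT.
Qed.

(** Partition counts never exceed [upcount], and any finite set of beginnings is fully counted once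
    the mesh is below the durations of its excursions. *)
Lemma partition_count_cvg D a b x : A <= a -> a < b -> b <= B ->
  partition_count D a (dyadic a b n) x @[n --> \oo] --> upcount a b D x.
Proof.
move=> Aa ab bB.
have le_up n : (partition_count D a (dyadic a b n) x <= upcount a b D x)%E.
  by apply: partition_count_le => //; exact: dyadic_partition.
apply: (cvg_ereal_sup le_up) => _ [F [finF FU] <-].
apply: filterS (finite_up_set_within (dyadic_mesh_cvg a b) finF FU) => n Fn.
rewrite -esum_fset //.
apply: le_trans (subset_esum_dirac _ Fn) _.
apply: esum_within_le => //; first exact: dyadic_partition.
by move=> p /dyadic_mesh ->.
Qed.

End level_counts.

(** * The mass of the beginnings of excursions *)

(** Both sides are sums over a product, identified by swapping the coordinates. *)
Lemma esum_nneseries {R : realType} {T : choiceType} (I : set T)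
    (a : T -> nat -> \bar R) : (forall t n, 0 <= a t n)%E ->
  (\esum_(t in I) \sum_(n <oo) a t n = \sum_(n <oo) \esum_(t in I) a t n)%E.
Proof.
move=> a0; rewrite nneseries_esumT; last by move=> n; exact: esum_ge0.
under eq_esum do rewrite nneseries_esumT //.
rewrite esum_esum // esum_esum //.
rewrite (reindex_esum ([set: nat] `*`` (fun=> I)) _ (fun x => (x.2, x.1))) //.
split => //= [[n t] [] //|[n t] [m r] /= _ _ [-> ->] //|].
by move=> [t n] [/= It _]; exists (n, t).
Qed.

Section excursion_mass.
Context {R : realType} (w : R -> R) (A B : R).
Hypothesis w_cont : {within `[A, B], continuous w}.
Implicit Types (a b x : R) (D : set (measurableTypeR R)).

Definition up_mass a b D : \bar R :=
  (\int[lebesgue_measure]_x upcount w a b D x)%E.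

Lemma upcount_ge0 a b D x : (0 <= upcount w a b D x)%E.
Proof. exact: esum_dirac_ge0. Qed.

Lemma measurable_up_levels D u v : measurable D ->
  measurable (up_levels w D u v : set (measurableTypeR R)).
Proof.
move=> mD; apply: measurableI => //.
rewrite -[X in measurable X]setTI.
exact: (nondecreasing_measurable measurableT (@last_passage_homo R w u v)).
Qed.

Lemma measurable_partition_count D a s : measurable D ->
  measurable_fun [set: measurableTypeR R] (partition_count w D a s).
Proof.
move=> mD; apply: emeasurable_sum => p.
by apply/measurable_EFinP/measurable_indic; exact: measurable_up_levels.
Qed.

Lemma measurable_upcount a b D : A <= a -> a <= b -> b <= B -> measurable D ->
  measurable_fun [set: measurableTypeR R] (upcount w a b D).
Proof.
move=> Aa; rewrite le_eqVlt => /predU1P[<- _ _|ab bB mD].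
  by rewrite (_ : upcount _ _ _ _ = cst 0%E) //; apply/funext => x;
    rewrite upcount_xx.
apply: (emeasurable_fun_cvg (fun n => partition_count w D a (dyadic a b n))).
  by move=> n; exact: measurable_partition_count.
by move=> x _; exact: partition_count_cvg.
Qed.

Lemma integral_partition_count a b s : A <= a -> b <= B ->
  itv_partition a b s ->
  (\int[lebesgue_measure]_x partition_count w setT a s x = (upsum w a s)%:E)%E.
Proof.
move=> Aa bB ps; rewrite /partition_count ge0_integral_sum //; last first.
  move=> p; apply/measurable_EFinP/measurable_indic.
  exact: measurable_up_levels.
rewrite /upsum -sumEFin; apply: eq_big_seq => -[u v] /(steps_itv ps) /= [au uv
  vb].
rewrite integral_indic //; last exact: measurable_up_levels.
rewrite setIT /up_levels preimage_setT setIT.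
transitivity (lebesgue_measure (`[pinf w u v, w v[%classic : set R)) => //.
rewrite lebesgue_measure_itv /= lte_fin.
have : pinf w u v <= w v by apply: (pinf_ler w_cont); apply/andP; split; lra.
by rewrite le_eqVlt => /predU1P[->|->]; rewrite ?ltxx ?subrr // EFinB.
Qed.

Lemma upsum_le_up_mass a b s : A <= a -> b <= B -> itv_partition a b s ->
  ((upsum w a s)%:E <= up_mass a b setT)%E.
Proof.
move=> Aa bB ps; rewrite -(integral_partition_count Aa bB ps).
apply: ge0_le_integral => //.
- by move=> x _; apply: sume_ge0 => p _; rewrite lee_fin indicE ler0n.
- exact: measurable_partition_count.
- by apply: measurable_upcount => //; exact: itv_partition_le ps.
- by move=> x _; apply: (partition_count_le w_cont).
Qed.

Lemma up_mass_le a b (c : \bar R) : A <= a -> a < b -> b <= B ->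
  (forall s, itv_partition a b s -> ((upsum w a s)%:E <= c)%E) ->
  (up_mass a b setT <= c)%E.
Proof.
move=> Aa ab bB hc.
pose f n := partition_count w setT a (dyadic a b n).
(* Writing the count as a lower limit of dyadic counts lets Fatou's lemma bound its integral by the
   lower limit of the dyadic [upsum]. *)
have -> : up_mass a b setT = (\int[lebesgue_measure]_x limn_einf (f ^~ x))%E.
  apply: eq_integral => x _; apply/esym.
  by rewrite (cvg_limn_einf_sup (partition_count_cvg w_cont Aa ab bB)).
apply: le_trans (fatou _ _ _ _) _ => //.
- by move=> n; exact: measurable_partition_count.
- by move=> n x _; apply: sume_ge0 => p _; rewrite lee_fin indicE ler0n.
have hint n : (\int[lebesgue_measure]_x f n x =
    (upsum w a (dyadic a b n))%:E)%E.
  exact: (integral_partition_count Aa bB (dyadic_partition n ab)).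
under [X in limn_einf X]eq_fun do rewrite hint.
rewrite limn_einf_lim; apply: lime_le; first exact: is_cvg_einfs.
apply: nearW => n; apply: ge_ereal_inf; exists (upsum w a (dyadic a b n))%:E.
  by exists n => /=.
by apply: hc; exact: dyadic_partition.
Qed.

(** One inequality combines [up_mass_le] with [upsum_le_total_variation], the other
    [upsum_le_up_mass] with [variation_le_upsum]. Infinite values are split off before real
    arithmetic. *)
Lemma up_mass_total_variation a b : A <= a -> a <= b -> b <= B ->
  (2%:E * up_mass a b setT = total_variation a b w + (w b - w a)%:E)%E.
Proof.
move=> Aa; rewrite le_eqVlt => /predU1P[<- _|ab bB].
  rewrite total_variationxx subrr adde0 /up_mass integral0_eq ?mule0 // => x _.
  exact: upcount_xx.
have u0 : (0 <= up_mass a b setT)%E.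
  by apply: integral_ge0 => x _; exact: upcount_ge0.
have tv0 := total_variation_ge0 w (ltW ab).
apply/eqP; rewrite eq_le; apply/andP; split.
  have [->|tvfin] := eqVneq (total_variation a b w) +oo%E.
    by rewrite addye ?leey.
  have {tvfin} : total_variation a b w \is a fin_num
    by rewrite ge0_fin_numE ?ltey.
  move=> /fineK tvE.
  rewrite -tvE -EFinD.
  set c := _ + _; have -> : c%:E = (2%:E * (c / 2)%:E)%E
    by rewrite -EFinM mulrC divfK.
  rewrite lee_pmul2l //; apply: up_mass_le => // s ps.
  have := upsum_le_total_variation w_cont Aa bB ps.
  by rewrite -tvE -EFinD !lee_fin -/c; lra.
have [->|ufin] := eqVneq (up_mass a b setT) +oo%E.
  by rewrite gt0_muley ?leey // lte_fin.
have {ufin} /fineK uE : up_mass a b setT \is a fin_num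
  by rewrite ge0_fin_numE ?ltey.
rewrite -uE -EFinM -leeBrDr // -EFinB; apply: ge_ereal_sup.
move=> _ [_ [s ps <-] <-]; rewrite lee_fin.
have := upsum_le_up_mass Aa bB ps; rewrite -uE lee_fin.
by have := variation_le_upsum w_cont Aa bB ps; lra.
Qed.

Lemma upcount_bigcup a b (F : (set (measurableTypeR R))^nat) x :
  (forall n, measurable (F n)) -> trivIset setT F ->
  (upcount w a b (\bigcup_n F n) x = \sum_(n <oo) upcount w a b (F n) x)%E.
Proof.
move=> mF tF; rewrite /upcount -esum_nneseries; last first.
  by move=> s n; exact: dirac_ge0.
apply: eq_esum => s _; rewrite measure_semi_bigcup //.
exact: bigcupT_measurable.
Qed.

(** Dirac masses are countably additive at each level, and integration over the levels commutes with
    series of nonnegative measurable functions. *)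
Lemma up_mass_measure a b : A <= a -> a <= b -> b <= B ->
  exists mu : {measure set (measurableTypeR R) -> \bar R}, mu =1 up_mass a b.
Proof.
move=> Aa ab bB.
have m0 : up_mass a b set0 = 0%E.
  apply: integral0_eq => x _; apply: esum1 => s _.
  by rewrite diracE in_set0.
have mge0 D : (0 <= up_mass a b D)%E.
  by apply: integral_ge0 => x _; exact: upcount_ge0.
have msa : semi_sigma_additive (up_mass a b).
  move=> F mF tF mUF; rewrite /up_mass.
  under [X in _ --> X]eq_integral do rewrite upcount_bigcup //.
  rewrite integral_nneseries //.
  - by apply: is_cvg_nneseries => n _ _; exact: mge0.
  - by move=> n; exact: measurable_upcount.
  - by move=> n x _; exact: upcount_ge0.
pose M := isMeasure.Build _ _ _ (up_mass a b) m0 mge0 msa.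
pose mu : {measure set (measurableTypeR R) -> \bar R} :=
  HB.pack (up_mass a b) M.
by exists mu.
Qed.

End excursion_mass.

(** * Arcs issued from the root *)

Section metric_path.
Context {R : realType} {T : metricType R}.

Definition lipschitz1 (F : T -> R) : Prop :=
  forall x y, `|F x - F y| <= mdist x y.

Lemma lipschitz1_continuous (F : T -> R) : lipschitz1 F -> continuous F.
Proof.
move=> hF x; apply/cvgrPdist_lt => e e0; apply/nbhs_ballP.
exists e => // y; rewrite ballEmdist /= => xy.
exact: le_lt_trans (hF x y) xy.
Qed.

Lemma mdist_lipschitz1 (z : T) : lipschitz1 (mdist ^~ z).
Proof.
move=> x y; rewrite ler_norml; apply/andP; split.
  by have := metric_triangle y x z; rewrite (metric_sym y x); lra.
by have := metric_triangle x y z; lra.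
Qed.

(* If [z] separates [C] from its complement, then the distance to [z], signed
   according to the side, is still 1-Lipschitz, so that the intermediate value
   theorem applies to it along any path. *)
Lemma path_separation (C : set T) (z : T) (L p q : R) (g : R -> T) :
  (forall x y, C x -> ~ C y -> mdist x z + mdist y z <= mdist x y) ->
  {within `[0, L], continuous g} -> 0 <= p -> p <= q -> q <= L ->
  (C (g p) /\ ~ C (g q)) \/ (~ C (g p) /\ C (g q)) ->
  exists2 r, p <= r <= q & g r = z.
Proof.
move=> hC gc p0 pq qL hpq.
pose F x := if x \in C then mdist x z else - mdist x z.
have FC x : C x -> F x = mdist x z by move=> Cx; rewrite /F mem_set.
have FN x : ~ C x -> F x = - mdist x z by move=> Cx; rewrite /F memNset.
have hF : lipschitz1 F.
  move=> x y; have tri := mdist_lipschitz1 z x y.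
  have h1 := mdist_ge0 x z; have h2 := mdist_ge0 y z.
  have [Cx|Cx] := pselect (C x); have [Cy|Cy] := pselect (C y).
  - by rewrite !FC.
  - by rewrite FC // FN // opprK ger0_norm ?addr_ge0 //; exact: hC.
  - rewrite FN // FC // -opprD normrN ger0_norm ?addr_ge0 // addrC.
    by rewrite (metric_sym x y); exact: hC.
  - by rewrite !FN // -opprD normrN.
have [||r] := @IVT _ (F \o g) p q 0 pq.
- apply: (@continuous_subspaceW _ _ _ `[0, L]%classic).
    by move=> r /=; rewrite !in_itv /= => /andP[? ?]; apply/andP; split; lra.
  apply/subspace_continuousP => r rL.
  have /subspace_continuousP/(_ r rL) := gc; move/cvg_comp; apply.
  exact: lipschitz1_continuous.
- have h1 := mdist_ge0 (g p) z; have h2 := mdist_ge0 (g q) z.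
  rewrite ge_min le_max /=.
  case: hpq => -[Cp Cq]; rewrite ?(FC _ Cp) ?(FC _ Cq) ?(FN _ Cp) ?(FN _ Cq);
    by rewrite !oppr_le0 h1 h2 /= ?orbT.
rewrite in_itv /= => rpq Fr; exists r => //.
apply: mdist_positivity; move: Fr; rewrite /F.
by case: ifP => _ // /eqP; rewrite oppr_eq0 => /eqP.
Qed.

End metric_path.

Section tree_arcs.
Context {R : realType} (w : R -> R) (w_cont : {within `[0, 1], continuous w}).
Context (U : time R).
Hypothesis U_min : forall t, t \in `[0, 1] -> w (val U) <= w t.
Local Notation T := (tree w_cont).
Local Notation O := (tree_pi w_cont U).
Implicit Types x y z : T.

Definition tree_height x : R := w (val (tree_repr x)).
(** The height of the branch point of [x] and [y], where the arcs to them from the root separate. *)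
Definition tree_meet x y : R := pinf w (val (tree_repr x)) (val (tree_repr y)).

Let time01 (t : time R) : 0 <= val t <= 1.
Proof. by have := valP t; rewrite in_itv. Qed.

Lemma tree_mdistE x y : mdist x y =
  tree_height x + tree_height y - 2 * tree_meet x y.
Proof. by []. Qed.

Lemma tree_meetC x y : tree_meet x y = tree_meet y x. Proof. exact: pinfC. Qed.

Lemma tree_meet_lel x y : tree_meet x y <= tree_height x.
Proof. exact: (pinf_lel w_cont). Qed.

Lemma tree_meet_ler x y : tree_meet x y <= tree_height y.
Proof. exact: (pinf_ler w_cont). Qed.

Lemma tree_meetxx x : tree_meet x x = tree_height x.
Proof. by have := mdistxx x; rewrite tree_mdistE; lra. Qed.

(** Sharing ancestors up to height [c] is a transitive relation. *)
Lemma tree_meet_min y x z c : c <= tree_meet x y -> c <= tree_meet y z ->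
  c <= tree_meet x z.
Proof.
move=> h1 h2; apply: le_trans (pinf_min w_cont (time01 _) (time01 (tree_repr
  y)) (time01 _)).
by rewrite le_min h1.
Qed.

(** Two times at distance 0 both attain the infimum between them, so the value of the path descends
    to the quotient. *)
Lemma tree_height_pi t : tree_height (tree_pi w_cont t) = w (val t).
Proof.
have : tree_delta w (val (tree_repr (tree_pi w_cont t))) (val t) = 0.
  by apply/(tree_piE w_cont); rewrite tree_reprK.
rewrite /tree_delta -/(pinf _ _ _) /tree_height; set r := val (tree_repr _).
have := pinf_lel w_cont (time01 (tree_repr (tree_pi w_cont t))) (time01 t).
have := pinf_ler w_cont (time01 (tree_repr (tree_pi w_cont t))) (time01 t).
by rewrite -/r; lra.
Qed.

Lemma tree_meet_pi s t :
  tree_meet (tree_pi w_cont s) (tree_pi w_cont t) = pinf w (val s) (val t).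
Proof.
have := tree_distE w_cont s t.
rewrite -[tree_dist _ _]/(mdist (tree_pi w_cont s) (tree_pi w_cont t)).
rewrite tree_mdistE !tree_height_pi /tree_delta.
by rewrite -/(pinf _ _ _); lra.
Qed.

Lemma tree_height_root x : tree_height O <= tree_height x.
Proof. by rewrite tree_height_pi; apply: U_min; exact: valP. Qed.

Lemma tree_meet_root x : tree_meet O x = tree_height O.
Proof.
apply/eqP; rewrite eq_le tree_meet_lel /=; apply: le_pinf => r hr.
rewrite tree_height_pi; apply: U_min; rewrite in_itv /=.
have /andP[a0 a1] := time01 (tree_repr O).
have /andP[b0 b1] := time01 (tree_repr x).
case/andP: hr => h1 h2; rewrite (le_trans _ h1) ?le_min ?a0 //.
by rewrite (le_trans h2) // ge_max a1.
Qed.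

Lemma tree_meet_eq x y : tree_meet x y = tree_height x ->
  tree_height x = tree_height y -> x = y.
Proof.
by move=> h1 h2; apply: mdist_positivity; rewrite tree_mdistE h1; lra.
Qed.

(** The witness is the point visited at the last passage at level [c] between [U] and a time of [x];
    from there to [x] the path stays at or above [c]. *)
Lemma exists_ancestor x c : tree_height O <= c -> c <= tree_height x ->
  exists2 z, tree_height z = c & tree_meet z x = c.
Proof.
move: (tree_repr x) (tree_reprK x) => t <-.
rewrite !tree_height_pi => Uc wct.
suff [s s01 [ws hs]] : exists2 s, s \in `[0, 1] &
    w s = c /\ forall r, Num.min s (val t) <= r <= Num.max s (val t) ->
      c <= w r.
  exists (tree_pi w_cont (exist _ s s01)); first by rewrite tree_height_pi;
    exact: ws.
  rewrite tree_meet_pi /=; apply/eqP; rewrite eq_le le_pinf // andbT -ws.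
  by apply: (pinf_lel w_cont); [rewrite in_itv in s01|exact: time01].
have /andP[U0 U1] := time01 U; have /andP[t0 t1] := time01 t.
have [Ut|tU] := leP (val U) (val t).
  have hU : val U <= val U <= val t by rewrite lexx.
  have [/andP[h1 h2] ws hs] := last_passageP w_cont U0 t1 hU Uc wct.
  exists (last_passage w (val U) (val t) c).
    by rewrite in_itv /= (le_trans U0 h1) (le_trans h2 t1).
  split => // r; rewrite (min_l h2) (max_r h2) => /andP[].
  rewrite le_eqVlt => /predU1P[<- _|h3 h4]; first by rewrite ws.
  by apply/ltW/hs/andP.
(* When [x] is visited before [U], time is reversed so that the path again runs from [U] to [x]. *)
have wN : {within `[- 1, - 0], continuous (w \o -%R)}.
  by apply: within_continuous_compN; rewrite !opprK.
have hU : - val U <= - val U <= - val t by rewrite lexx lerN2 ltW.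
have wNU : (w \o -%R) (- val U) <= c by rewrite /= opprK.
have wNt : c <= (w \o -%R) (- val t) by rewrite /= opprK.
have hU1 : -1 <= - val U by rewrite lerN2.
have ht1 : - val t <= - 0 by rewrite lerN2.
have [/andP[h1 h2] ws hs] := last_passageP wN hU1 ht1 hU wNU wNt.
set s := last_passage _ _ _ _ in h1 h2 ws hs.
have ts : val t <= - s by rewrite lerNr.
exists (- s).
  by rewrite in_itv /= (le_trans t0 ts) lerNl (le_trans _ h1) // lerN2.
split => // r; rewrite (min_r ts) (max_l ts) => /andP[h3].
rewrite le_eqVlt => /predU1P[->|h4];
  first by rewrite -[w (- s)]/((w \o -%R) s) ws.
have := hs (- r); rewrite /= opprK => hr; apply/ltW/hr.
by rewrite ltrNr h4 lerN2.
Qed.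

(** The points of the arc from the root to [y], described by heights alone; see [arc_rootE]. *)
Definition ancestors y : set T := [set x | tree_meet x y = tree_height x].

Lemma ancestorsE x y : ancestors y x <-> tree_height x <= tree_meet x y.
Proof.
split=> [->//|h]; apply/eqP; by rewrite /ancestors /= eq_le tree_meet_lel.
Qed.

(** The arc is parametrized by height above the root. Two ancestors of [y] meet at the lower of
    their heights, so the parametrization is an isometry. *)
Lemma ancestors_arc y : is_arc O y (ancestors y).
Proof.
pose g (t : R) : T :=
  [get z | tree_height z = tree_height O + t /\ tree_meet z y =
    tree_height O + t].
pose L := tree_height y - tree_height O.
have gP t : 0 <= t <= L ->
    tree_height (g t) = tree_height O + t /\ tree_meet (g t) y =
      tree_height O + t.
  move=> /andP[t0 tL].
  apply: (@getPex _ [set z | tree_height z =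
    tree_height O + t /\ tree_meet z y = tree_height O + t]).
  have [||z hz mz] := @exists_ancestor y (tree_height O + t); last by exists z.
    by rewrite lerDl.
  by rewrite /L in tL; lra.
have g_isometric s t : 0 <= s <= L -> 0 <= t <= L ->
  mdist (g s) (g t) = `|s - t|.
  move=> hs ht; have [hs1 hs2] := gP s hs; have [ht1 ht2] := gP t ht.
  have h1 := tree_meet_lel (g s) (g t); have h2 := tree_meet_ler (g s) (g t).
  have h3 : tree_height O + Num.min s t <= tree_meet (g s) (g t).
    apply: (@tree_meet_min y); first by rewrite hs2 lerD2l ge_min lexx.
    by rewrite tree_meetC ht2 lerD2l ge_min lexx orbT.
  rewrite tree_mdistE; move: h1 h2 h3; rewrite hs1 ht1.
  case: (leP s t) => st h1 h2 h3.
    by rewrite ler0_norm ?subr_le0 //; lra.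
  by rewrite gtr0_norm ?subr_gt0 //; lra.
have L0 : 0 <= L by rewrite subr_ge0 tree_height_root.
exists L, g; split=> //.
- apply/subspace_continuousP => t; rewrite /= in_itv /= => ht.
  apply/metricType_numDomainType.cvgrPdist_lt => e e0.
  apply/nbhs_ballP; exists e => // s; rewrite /ball /= => ts.
  by rewrite in_itv /= => hs; rewrite g_isometric.
- move=> s t; rewrite !in_itv /= => hs ht gst.
  have := g_isometric s t hs ht; rewrite gst mdistxx => /esym/normr0_eq0.
  by move/eqP; rewrite subr_eq0 => /eqP.
- split.
    have [|h1 h2] := gP 0; first by rewrite lexx.
    by apply/esym/tree_meet_eq; rewrite ?tree_meet_root // h1 addr0.
  have [|h1 h2] := gP L; first by rewrite lexx andbT.
  by apply: tree_meet_eq; rewrite ?h1 ?h2 // /L; ring.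
- apply/seteqP; split => x /=; last first.
    move=> [t tI <-]; have [|h1 h2] := gP t;
      last by rewrite /ancestors /= h1 h2.
    by move: tI; rewrite /= ?in_itv.
  move=> xy; have xy' : tree_height x <= tree_height y
    by rewrite -xy tree_meet_ler.
  have Ox := tree_height_root x.
  have tI : 0 <= tree_height x - tree_height O <= L by apply/andP; split;
    rewrite /L; lra.
  exists (tree_height x - tree_height O); first by rewrite /= in_itv.
  have [h1 h2] := gP _ tI; set z := g _ in h1 h2 *.
  have hz : tree_height z = tree_height x by lra.
  apply: tree_meet_eq => //; apply/eqP; rewrite eq_le tree_meet_lel /= hz.
  by apply: (@tree_meet_min y); [lra|rewrite tree_meetC xy].
Qed.

(** A point [x] of an arc that is no ancestor of [y] lies strictly above its branch point [z] with
    [y]. As [z] separates [x] from both ends, the arc visits [z] before and after [x], against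
    injectivity. *)
Lemma arc_rootE y : Defs.arc O y = ancestors y.
Proof.
apply/seteqP; split => x; last first.
  by move=> xy; exists (ancestors y) => //; exact: ancestors_arc.
move=> [_ [L [g [L0 gc ginj [g0 gL] ->]]] [a aL gax]].
move: (aL); rewrite /= in_itv /= => /andP[a0 aL'].
apply/ancestorsE; rewrite leNgt; apply/negP => cx; set c := tree_meet x y in cx.
have Oc : tree_height O <= c.
  by apply: (@tree_meet_min O); rewrite ?(tree_meetC x) tree_meet_root.
have [z hz mz] := exists_ancestor Oc (ltW cx).
(* [C] collects the points whose branch point with [x] is strictly higher than [z]: the side of [z]
   on which [x] lies. *)
pose C : set T := [set q | c < tree_meet q x].
have sep p q : C p -> ~ C q -> mdist p z + mdist q z <= mdist p q.
  rewrite /C /= => Cp /negP; rewrite -leNgt => Cq.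
  have h1 : c <= tree_meet p z by apply: (@tree_meet_min x);
    [exact: ltW|rewrite tree_meetC mz].
  have h2 : tree_meet q x <= tree_meet q z
    by apply: (@tree_meet_min x) => //; rewrite (tree_meetC x) mz.
  have h3 : tree_meet p q <= tree_meet q x.
    have [|h] := leP (tree_meet p q) (tree_meet p x).
      by move=> h; apply: (@tree_meet_min p) => //; rewrite (tree_meetC q).
    have : tree_meet p x <= tree_meet q x by apply: (@tree_meet_min p) => //;
      rewrite (tree_meetC q) ltW.
    by lra.
  have := tree_meet_ler q z; rewrite hz => h4.
  by rewrite !tree_mdistE hz; lra.
have Cx : C (g a) by rewrite gax /C /= tree_meetxx.
have CO : ~ C (g 0) by rewrite g0 /C /= tree_meet_root; lra.
have Cy : ~ C (g L) by rewrite gL /C /= tree_meetC -/c ltxx.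
have [r1 /andP[r10 r1a] gr1] :=
  path_separation sep gc (lexx 0) a0 aL' (or_intror (conj CO Cx)).
have [r2 /andP[r2a r2L] gr2] :=
  path_separation sep gc a0 aL' (lexx L) (or_introl (conj Cx Cy)).
(* As [r1 <= a <= r2], equality identifies [x] with [z], although [z] is strictly lower. *)
have r12 : r1 = r2.
  apply: ginj; rewrite ?gr1 ?gr2 // in_itv /=; apply/andP; split; lra.
have ra : r1 = a by lra.
by move: cx; rewrite -gax -ra gr1 hz ltxx.
Qed.

End tree_arcs.

(** * Length of the tree *)

Lemma partition_le {R : realType} (a b : R) s t :
  itv_partition a b s -> t \in a :: s -> a <= t <= b.
Proof.
elim/(@itv_partition_ind R) => [{}b|{}a y {}b {}s ay yb _ ih].
  by rewrite inE => /eqP ->; rewrite lexx.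
rewrite inE => /predU1P[->|/ih/andP[yt ->]].
  by rewrite lexx (le_trans (ltW ay)).
by rewrite (le_trans (ltW ay)).
Qed.

Lemma partition_dense {R : realType} (a b h : R) s t :
  itv_partition a b s -> {in steps a s, forall p, p.2 <= p.1 + h} -> 0 <= h ->
  a <= t <= b -> exists2 q, q \in a :: s & t <= q <= t + h.
Proof.
move=> + + h0; elim/(@itv_partition_ind R) =>
    [{}b|{}a y {}b {}s ay yb _ ih] hs /andP[at_ tb].
  by exists b; [rewrite inE eqxx|lra].
have [ta|ta] := leP t a; first by exists a; [rewrite inE eqxx|lra].
have [ty|ty] := leP t y.
  exists y; first by rewrite !inE eqxx orbT.
  have := hs (a, y); rewrite steps_cons inE eqxx => /(_ isT) /= ?.
  by lra.
have [||q qs hq] := ih.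
- by move=> p ps; apply: hs; rewrite steps_cons inE ps orbT.
- by rewrite (ltW ty).
by exists q => //; rewrite inE qs orbT.
Qed.

Lemma dyadic_dense {R : realType} (a b t e : R) : a < b -> a <= t <= b ->
  0 < e ->
  exists n, exists2 q, q \in a :: dyadic a b n & t <= q < t + e.
Proof.
move=> ab tab e0.
have [n _ /(_ _ (leqnn n)) /= he] : \forall n \near \oo, (b - a) / 2 ^+ n < e.
  exact: (cvgr_lt 0 (dyadic_mesh_cvg a b)).
have h0 : 0 <= (b - a) / 2 ^+ n by rewrite divr_ge0 ?exprn_ge0 // subr_ge0 ltW.
have mesh : {in steps a (dyadic a b n), forall p, p.2 <= p.1 + (b - a) / 2 ^+
  n}.
  by move=> p /dyadic_mesh ->.
have [q qn /andP[tq qt]] := partition_dense (dyadic_partition n ab) mesh h0 tab.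
by exists n, q => //; rewrite tq (le_lt_trans qt) // ltrD2l.
Qed.

Lemma dyadic_subset {R : realType} (a b : R) n m : (n <= m)%N ->
  {subset a :: dyadic a b n <= a :: dyadic a b m}.
Proof.
move=> nm q; rewrite !inE => /predU1P[->|/mapP[k]]; first by rewrite eqxx.
rewrite mem_iota => /andP[k0 k2] ->; apply/orP; right.
apply/mapP; exists (k * 2 ^ (m - n))%N.
  rewrite mem_iota muln_gt0 k0 expn_gt0 /= add1n ltnS.
  by rewrite -{2}(subnK nm) addnC expnD leq_mul2r -ltnS -add1n k2 orbT.
have -> : 2 ^+ m = 2 ^+ n * 2 ^+ (m - n) :> R by rewrite -exprD subnKC.
have h2 i : 2 ^+ i != 0 :> R by rewrite expf_neq0.
by rewrite natrM natrX; field; rewrite !h2.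
Qed.

Section tree_length.
Context {R : realType} (w : R -> R) (w_cont : {within `[0, 1], continuous w}).
Context (U : time R).
Hypothesis U_min : forall t, t \in `[0, 1] -> w (val U) <= w t.
Local Notation T := (tree w_cont).
Local Notation O := (tree_pi w_cont U).
Implicit Types x y z : T.

Lemma measurable_zeros (F : T -> R) : continuous F ->
  measurable ([set x | F x = 0] : set (borel_tree w_cont)).
Proof.
move=> cF; rewrite -[X in measurable X]setCK; apply: measurableC.
apply: sub_sigma_algebra; apply: closed_openC.
by apply: (@preimage_closed _ _ F [set r | r = 0]); [move=> x _;
  exact: cF|exact: closed_eq].
Qed.

(** The ancestors of [y] are the points where the triangle inequality between the root and [y] is an
    equality, which is a closed condition. *)
Lemma measurable_ancestors y :
  measurable (ancestors y : set (borel_tree w_cont)).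
Proof.
have e x : mdist x O + mdist x y - mdist O y =
  2 * (tree_height x - tree_meet x y).
  by rewrite !tree_mdistE (tree_meetC x O) !(tree_meet_root U_min); ring.
have -> : ancestors y = [set x | mdist x O + mdist x y - mdist O y = 0].
  apply/seteqP; split => x; rewrite /ancestors /= e.
    by move=> ->; rewrite subrr mulr0.
  by move/eqP; rewrite mulf_eq0 pnatr_eq0 /= subr_eq0 => /eqP/esym.
apply: measurable_zeros => x.
have c z : {for x, continuous (fun x : T => mdist x z : R)}.
  exact/lipschitz1_continuous/mdist_lipschitz1.
exact: (cvgB (cvgD (c O) (c y)) (cvg_cst _)).
Qed.

Lemma measurable_tree_set1 y : measurable ([set y] : set (borel_tree w_cont)).
Proof.
have -> : [set y] = [set x | mdist x y = 0].
  apply/seteqP; split => x /= => [->|]; first exact: mdistxx.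
  exact: mdist_positivity.
apply: (@measurable_zeros (mdist ^~ y)); apply: lipschitz1_continuous.
exact: mdist_lipschitz1.
Qed.

(** Real times let partitions act on the tree; times outside [0, 1] are sent to time 0. *)
Definition point_at (t : R) : T :=
  tree_pi w_cont (insubd (exist _ 0 (@time0_subproof R) : time R) t).

Lemma tree_height_point_at t : 0 <= t <= 1 -> tree_height (point_at t) = w t.
Proof. by move=> t01; rewrite tree_height_pi insubdK // inE in_itv. Qed.

Lemma tree_meet_point_at s t : 0 <= s <= 1 -> 0 <= t <= 1 ->
  tree_meet (point_at s) (point_at t) = pinf w s t.
Proof. by move=> s01 t01; rewrite tree_meet_pi !insubdK // inE in_itv. Qed.

Lemma point_at_surj x : exists2 t, 0 <= t <= 1 & x = point_at t.
Proof.
exists (val (tree_repr x)); first by have := valP (tree_repr x); rewrite in_itv.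
by rewrite /point_at valKd tree_reprK.
Qed.

Definition tree_span (s : seq R) : set T :=
  \bigcup_(t in [set` s]) ancestors (point_at t).

Lemma measurable_span s : measurable (tree_span s : set (borel_tree w_cont)).
Proof.
apply: fin_bigcup_measurable; first exact: finite_seq.
by move=> t _; exact: measurable_ancestors.
Qed.

Lemma tree_span_cons t s : tree_span (t :: s) =
  ancestors (point_at t) `|` tree_span s.
Proof.
apply/seteqP; split => [x [r /=]|x [xt|[r rs xr]]].
- by rewrite inE => /predU1P[->|rs] xr; [left|right; exists r].
- by exists t => //=; rewrite inE eqxx.
- by exists r => //=; rewrite inE; apply/orP; right.
Qed.

(** If [y], visited at time [t], is strictly above [x], the path stays higher than [x] shortly after
    [t], hence up to some dyadic time, whose point is also strictly above [x]. Thus the leaves are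
    measurable and the dyadic spans cover all other points. *)
Lemma leavesE : leaves O =
  ~` \bigcup_n \bigcup_(q in [set` 0 :: dyadic 0 1 n])
       (ancestors (point_at q) `\ point_at q).
Proof.
apply/seteqP; split => x /=.
- move=> hx [n _ [q _ [xq /= nq]]].
  by apply: nq; apply/esym/hx; rewrite /above (arc_rootE U_min).
- move=> hx y; rewrite /above (arc_rootE U_min) => xy.
  have [yx|yx] := eqVneq (tree_height y) (tree_height x).
    by apply/esym/tree_meet_eq => //; rewrite yx.
  exfalso; apply: hx.
  have {}yx : tree_height x < tree_height y.
    by rewrite lt_neqAle eq_sym yx -[leLHS]xy; exact: tree_meet_ler.
  have [t t01 yE] := point_at_surj y.
  have wt : tree_height y = w t by rewrite yE tree_height_point_at.
  have [|d d0 hd] := within_continuous_dist w_cont t01 (e :=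
    tree_height y - tree_height x).
    by rewrite subr_gt0.
  have [n [q qn /andP[tq qt]]] := dyadic_dense (@ltr01 R) t01 d0.
  have q01 : 0 <= q <= 1 by exact: partition_le (dyadic_partition _ ltr01) qn.
  have wq r : t <= r <= q -> tree_height x < w r.
    move=> /andP[tr rq]; have : `|w r - w t| < tree_height y - tree_height x.
      apply: hd; first by case/andP: t01; case/andP: q01 => *; apply/andP;
        split; lra.
      by rewrite ger0_norm ?subr_ge0 //; lra.
    by rewrite wt ltr_distl => /andP[]; lra.
  exists n => //; exists q => //; split.
    apply/ancestorsE; apply: (@tree_meet_min _ _ _ y); first by rewrite xy.
    rewrite yE tree_meet_point_at //; apply: le_pinf_le => // r hr.
    exact/ltW/wq.
  move=> /= xq; have := wq q; rewrite tq lexx => /(_ isT).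
  by rewrite -tree_height_point_at // -xq ltxx.
Qed.

Lemma measurable_leaves : measurable (leaves O : set (borel_tree w_cont)).
Proof.
rewrite leavesE; apply: measurableC; apply: bigcupT_measurable => n.
apply: fin_bigcup_measurable; first exact: finite_seq.
move=> t _; apply: measurableD; first exact: measurable_ancestors.
exact: measurable_tree_set1.
Qed.

Variable lambda : {measure set (borel_tree w_cont) -> \bar R}.
Hypothesis lambda_length : is_length_measure O lambda.

Lemma lambda_ancestors y :
  lambda (ancestors y) = (tree_height y - tree_height O)%:E.
Proof.
rewrite -(arc_rootE U_min) lambda_length.2 tree_mdistE tree_meet_root //.
by congr EFin; ring.
Qed.

(** Two arcs from the root share exactly the arc to the branch point [z], which [exists_ancestor]
    provides. *)
Lemma lambda_ancestorsI x y :
  lambda (ancestors x `&` ancestors y) = (tree_meet x y - tree_height O)%:E.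
Proof.
have [||z hz mz] := @exists_ancestor R w w_cont U x (tree_meet x y).
- by apply: (@tree_meet_min _ _ _ O); rewrite ?(tree_meetC x) tree_meet_root.
- exact: tree_meet_lel.
rewrite -hz -lambda_ancestors; congr (lambda _).
have mzy : tree_meet x y <= tree_meet z y by apply: (@tree_meet_min _ _ _ x);
  rewrite ?mz.
apply/seteqP; split => p.
- move=> [px py]; have hp : tree_height p <= tree_meet x y.
    by apply: (@tree_meet_min _ _ _ p); rewrite ?(tree_meetC x) ?px ?py.
  apply/ancestorsE; apply: (@tree_meet_min _ _ _ x); first by rewrite px.
  by rewrite tree_meetC mz.
- move=> /ancestorsE pz; have hp : tree_height p <= tree_meet x y.
    by rewrite -hz; apply: le_trans pz (tree_meet_ler _ _).
  split; apply/ancestorsE; apply: (@tree_meet_min _ _ _ z) => //.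
    by rewrite mz.
  exact: le_trans mzy.
Qed.

(** The induction removes the leftmost point [a]: its arc meets the later span in the arc to the
    branch point of [a] and [y], and inclusion-exclusion adds [w y - pinf w a y]. *)
Lemma lambda_span a b s : 0 <= a -> b <= 1 -> itv_partition a b s ->
  lambda (tree_span (a :: s)) = (w a - w (val U) + upsum w a s)%:E.
Proof.
move=> + + ps; elim/(@itv_partition_ind R): ps =>
    [{}b|{}a y {}b {}s ay yb ps ih] a0 b1.
  rewrite tree_span_cons /tree_span set_nil bigcup_set0 setU0 lambda_ancestors.
  rewrite tree_height_pi tree_height_point_at ?a0 // /upsum big_nil addr0 //.
have a01 : 0 <= a <= 1 by apply/andP; split; lra.
have y01 : 0 <= y <= 1 by apply/andP; split; lra.
(* A common ancestor of [a] and a later [t] is no higher than the infimum on [a, t], hence than that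
   on [a, y]; so it is an ancestor of [y]. *)
have sub : ancestors (point_at a) `&` tree_span (y :: s) =
    ancestors (point_at a) `&` ancestors (point_at y).
  apply/seteqP; split => x [xa]; last by rewrite tree_span_cons => xy;
    split => //; left.
  move=> [t /= ts xt]; split=> //.
  have /andP[yt tb] := partition_le ps ts.
  have t01 : 0 <= t <= 1 by apply/andP; split; lra.
  have hx : tree_height x <= pinf w a t.
    rewrite -tree_meet_point_at //.
    by apply: (@tree_meet_min _ _ _ x); [rewrite tree_meetC xa|rewrite xt].
  apply/ancestorsE; apply: (@tree_meet_min _ _ _ (point_at a));
    first by rewrite xa.
  rewrite tree_meet_point_at //; apply: (le_trans hx).
  apply: le_pinf_le; first exact: ltW.
  move=> r /andP[ar ry]; apply: (pinf_le w_cont) => //.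
  have aret : a <= t by lra.
  by rewrite (min_l aret) (max_r aret) ar (le_trans ry).
rewrite tree_span_cons measureUfinl; last 3 first.
- exact: measurable_ancestors.
- exact: measurable_span.
- by rewrite lambda_ancestors ltry.
have y0 : 0 <= y by case/andP: y01.
rewrite sub lambda_ancestorsI lambda_ancestors ih //.
rewrite /upsum steps_cons big_cons /= tree_height_pi tree_height_point_at //
  tree_meet_point_at //.
by rewrite -!EFinD; congr EFin; ring.
Qed.

(** All spans lie in the tree, which bounds its mass from below through [up_mass_le]. The dyadic
    spans increase to the whole tree up to the null set of leaves, which bounds it from above. *)
Lemma lambda_tree :
  lambda setT = ((w 0 - w (val U))%:E + up_mass w 0 1 setT)%E.
Proof.
pose S n : set (borel_tree w_cont) := tree_span (0 :: dyadic 0 1 n).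
have mS n : measurable (S n) by exact: measurable_span.
have lS n : lambda (S n) = (w 0 - w (val U) + upsum w 0 (dyadic 0 1 n))%:E.
  exact: (lambda_span (lexx 0) (lexx 1) (dyadic_partition n ltr01)).
have mUS : measurable (\bigcup_n S n) by exact: bigcupT_measurable.
have ndS : {homo S : n m / (n <= m)%N >-> (n <= m)%O}.
  move=> n m nm; rewrite subsetEset => x [t tn xt].
  by exists t => //; exact: dyadic_subset nm _ tn.
apply/eqP; rewrite eq_le; apply/andP; split; last first.
  rewrite -leeBrDl //; apply: (up_mass_le w_cont) => // s ps.
  rewrite leeBrDl // -EFinD -(lambda_span (lexx 0) (lexx 1) ps).
  by apply: le_measure; rewrite ?inE //; exact: measurable_span.
have -> : [set: borel_tree w_cont] = \bigcup_n S n `|` leaves O.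
  apply/esym/seteqP; split => // x _.
  have [xl|] := pselect (leaves O x); first by right.
  rewrite leavesE => /contrapT[n _ [t tn [xt _]]].
  by left; exists n => //; exists t.
rewrite (measureU0 _ measurable_leaves lambda_length.1) //.
apply: cvge_le (nondecreasing_cvg_mu mS mUS ndS).
apply: nearW => n; rewrite /= lS EFinD leeD2lE //.
by apply: (upsum_le_up_mass w_cont) => //; exact: dyadic_partition.
Qed.

End tree_length.

(** * Jordan decompositions and excursion measures *)

Section jordan.
Local Open Scope ereal_scope.
Context d {T : measurableType d} {R : realType}.
Variable nu : {charge set T -> \bar R}.
Variables (P N : set T) (nuPN : hahn_decomposition nu P N).

Lemma jordan_posI A : measurable A -> jordan_pos nuPN A = nu (A `&` P).
Proof. by move=> mA; rewrite jordan_posE /= /crestr0 mem_set. Qed.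

Lemma jordan_negI A : measurable A -> jordan_neg nuPN A = - nu (A `&` N).
Proof.
by move=> mA; rewrite jordan_negE /= cscaleN1 /= /crestr0 mem_set.
Qed.

Lemma jordan_posB A : measurable A ->
  nu A = jordan_pos nuPN A - jordan_neg nuPN A.
Proof. by move=> mA; rewrite (jordan_decomp nuPN mA) /cadd /= cscaleN1. Qed.

(* The Jordan decomposition is minimal among the decompositions of [nu] as a
   difference of finite measures, and it is the only one of minimal mass. *)
Lemma jordan_minimal (mu1 mu2 : {measure set T -> \bar R}) :
  mu1 setT < +oo -> mu2 setT < +oo ->
  (forall A, measurable A -> nu A = mu1 A - mu2 A) ->
  mu1 setT + mu2 setT <= jordan_pos nuPN setT + jordan_neg nuPN setT ->
  forall A, measurable A ->
    mu1 A = jordan_pos nuPN A /\ mu2 A = jordan_neg nuPN A.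
Proof.
move=> fin1 fin2 nuE le_mass.
have finM (mu : {measure set T -> \bar R}) A : mu setT < +oo -> measurable A ->
    mu A \is a fin_num.
  move=> muT mA; rewrite ge0_fin_numE // (le_lt_trans _ muT) //.
  by apply: le_measure; rewrite ?inE.
have [_ _ PNT _] := nuPN.
have mP : measurable P by case: nuPN => -[].
have mN : measurable N by case: nuPN => _ [].
have leP A : measurable A -> jordan_pos nuPN A <= mu1 A.
  move=> mA; have mAP : measurable (A `&` P) by exact: measurableI.
  rewrite jordan_posI // nuE //; apply: (@le_trans _ _ (mu1 (A `&` P))).
    by rewrite leeBlDr ?finM // leeDl.
  by apply: le_measure; rewrite ?inE.
have leN A : measurable A -> jordan_neg nuPN A <= mu2 A.
  move=> mA; have mAN : measurable (A `&` N) by exact: measurableI.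
  rewrite jordan_negI // nuE // oppeB ?fin_num_adde_defl ?fin_numN ?finM //.
  apply: (@le_trans _ _ (mu2 (A `&` N))).
    by rewrite addeC leeBlDr ?finM // leeDl.
  by apply: le_measure; rewrite ?inE.
move=> A mA; have mC : measurable (~` A) by exact: measurableC.
have split_measure (mu : {measure set T ->
  \bar R}) : mu setT = mu A + mu (~` A).
  by rewrite -(setUv A) measureU // setICr.
have posT : jordan_pos nuPN setT = jordan_pos nuPN A + jordan_pos nuPN (~` A).
  exact: (split_measure (jordan_pos nuPN)).
have negT : jordan_neg nuPN setT = jordan_neg nuPN A + jordan_neg nuPN (~` A).
  exact: (split_measure (jordan_neg nuPN)).
have finJ B : measurable B ->
    jordan_pos nuPN B \is a fin_num /\ jordan_neg nuPN B \is a fin_num.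
  by move=> mB; split; apply: fin_num_measure.
(* Domination on [A] and on its complement, together with the bound on the total masses, leaves no
   room for a strict inequality. *)
move: le_mass; rewrite posT negT !split_measure.
move: (leP A mA) (leN A mA) (leP _ mC) (leN _ mC).
have [/fineK <- /fineK <-] := finJ _ mA.
have [/fineK <- /fineK <-] := finJ _ mC.
rewrite -(fineK (finM mu1 A fin1 mA)) -(fineK (finM mu2 A fin2 mA)).
rewrite -(fineK (finM mu1 _ fin1 mC)) -(fineK (finM mu2 _ fin2 mC)).
rewrite -!EFinD !lee_fin => h1 h2 h3 h4 h5.
by split; congr EFin; lra.
Qed.

End jordan.

(** * Masses of intervals and of points *)

Section interval_masses.
Context {R : realType}.
Implicit Types (w : R -> R) (A B a b x : R) (D : set (measurableTypeR R)).

Lemma eq_upcount w a b D D' x : (forall s, a <= s < b -> D s <-> D' s) ->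
  upcount w a b D x = upcount w a b D' x.
Proof.
move=> DD'; apply: eq_esum => s [ab _ _]; rewrite !diracE.
suff -> : (s \in D) = (s \in D') by [].
by apply/idP/idP; rewrite !inE => /(DD' s ab).
Qed.

Lemma upcount0 w a b x : upcount w a b set0 x = 0%E.
Proof. by apply: esum1 => s _; rewrite diracE in_set0. Qed.

Lemma eq_up_mass w a b D D' : (forall s, a <= s < b -> D s <-> D' s) ->
  up_mass w a b D = up_mass w a b D'.
Proof. by move=> DD'; apply: eq_integral => x _; exact: eq_upcount. Qed.

(** Cutting at [a] and [b] isolates the middle piece. Points of [up_set] lie strictly before the
    right end of their piece, hence the half-open interval. *)
Lemma up_mass_itv w A a b B : A <= a -> a <= b -> b <= B ->
  up_mass w A B `[a, b[ = up_mass w a b setT.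
Proof.
move=> Aa ab bB; apply: eq_integral => x _.
rewrite (upcountD _ _ _ Aa (le_trans ab bB)) (upcountD _ _ _ ab bB).
rewrite (@eq_upcount w A a _ set0); last first.
  by move=> s /andP[_ sa] /=; rewrite in_itv /=; split => // /andP[]; lra.
rewrite (@eq_upcount w b B _ set0); last first.
  by move=> s /andP[bs _] /=; rewrite in_itv /=; split => // /andP[]; lra.
rewrite !upcount0 add0e adde0; apply: eq_upcount => s ab'.
by split => // _; rewrite /= in_itv.
Qed.

(** The integrand vanishes at every level other than [w c], and a single level is Lebesgue null. *)
Lemma up_mass_set1 w a b c : up_mass w a b [set c] = 0%E.
Proof.
rewrite -(@integral_set1 R (upcount w a b [set c]) (w c)) integral_mkcond.
apply: eq_integral => x _; rewrite patchE; case: ifPn => //.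
rewrite notin_setE /= => xwc; apply: esum1 => s [_ _ wsx].
rewrite diracE memNset //= => sc; apply: xwc.
by rewrite -sc.
Qed.

End interval_masses.

(** * The excursion measures and time reversal *)

Section excursion_measures.
Context {R : realType} (w : R -> R).
Hypothesis w_cont : {within `[0, 1], continuous w}.
Implicit Types (a b x : R) (D : set (measurableTypeR R)).

Local Notation wN := (w \o -%R).

Let wN_cont : {within `[- 1, 0], continuous wN}.
Proof. by apply: within_continuous_compN; rewrite opprK oppr0. Qed.

Lemma omega_upE D : omega_up w D = up_mass w 0 1 D.
Proof.
apply: eq_integral => x _; congr (esum _ _); apply/seteqP; split => s /=.
- move=> [[/andP[s0 s1] [e e0 he]] ws]; split => //; first exact/andP.
  (* Halving [e] passes from a condition strictly before [s + e] to one that includes the endpoint;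
     the minimum keeps the witness in [0, 1]. *)
  exists (Num.min (s + e / 2) 1).
    by rewrite lt_min s1 ge_min lexx orbT andbT ltrDl divr_gt0.
  move=> u; rewrite le_min => /andP[su /andP[ue u1]].
  apply: he; first by rewrite in_itv /= u1 andbT (le_trans s0) // ltW.
  by rewrite su; lra.
- move=> [/andP[s0 s1] [v /andP[sv v1] hv] ws]; split => //.
  split; first exact/andP.
  exists (v - s); first by rewrite subr_gt0.
  by move=> r _ /andP[sr rv]; apply: hv; rewrite sr; lra.
Qed.

Lemma omega_downE D :
  omega_down w D = up_mass wN (- 1) 0 (-%R @^-1` D).
Proof.
apply: eq_integral => x _.
rewrite [LHS](reindex_esum (up_set wN (- 1) 0 x) _ -%R).
  by apply: eq_esum => s _; rewrite !diracE.
split=> [s|s t _ _ /oppr_inj //|t] /=.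
- move=> [/andP[s0 s1] [v /andP[sv v1] hv] ws]; split => //.
  split; first by apply/andP; split; lra.
  exists (v - s); first by rewrite subr_gt0.
  move=> r _ /andP[sr rv].
  have -> : r = - - r by rewrite opprK.
  by apply: hv; apply/andP; split; lra.
- move=> [[/andP[s0 s1] [e e0 he]] ws]; exists (- t); last by rewrite opprK.
  split; last by rewrite /= opprK.
    by apply/andP; split; lra.
  exists (Num.min (- t + e / 2) 0).
    by rewrite lt_min oppr_lt0 s0 ge_min lexx orbT andbT ltrDl divr_gt0.
  move=> u; rewrite le_min => /andP[su /andP[ue u1]] /=; rewrite opprK.
  by apply: he; [rewrite in_itv /=; apply/andP; split; lra|
    apply/andP; split; lra].
Qed.

Lemma omega_up_measure :
  exists mu : {measure set (measurableTypeR R) -> \bar R}, mu =1 omega_up w.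
Proof.
have [mu muE] := up_mass_measure w_cont (lexx 0) ler01 (lexx 1).
by exists mu => D; rewrite muE omega_upE.
Qed.

Lemma omega_down_measure :
  exists mu : {measure set (measurableTypeR R) -> \bar R}, mu =1 omega_down w.
Proof.
have [mu muE] := up_mass_measure wN_cont (lexx (- 1)) (lerN10 R) (lexx 0).
have mN : measurable_fun setT (-%R : measurableTypeR R -> measurableTypeR R).
  exact: oppr_measurable.
pose mu' : {measure set (measurableTypeR R) -> \bar R} :=
  HB.pack (pushforward mu (-%R : measurableTypeR R -> measurableTypeR R)).
by exists (mu' mN) => D; rewrite omega_downE -muE.
Qed.

Lemma omega_up_itv a b : 0 <= a -> a <= b -> b <= 1 ->
  (2%:E * omega_up w `[a, b[ = total_variation a b w + (w b - w a)%:E)%E.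
Proof.
by move=> a0 ab b1; rewrite omega_upE up_mass_itv //;
  exact: up_mass_total_variation.
Qed.

(** Reversing time keeps the total variation and changes the sign of the increment. *)
Lemma omega_down_itv a b : 0 <= a -> a <= b -> b <= 1 ->
  (2%:E * omega_down w `]a, b] = total_variation a b w - (w b - w a)%:E)%E.
Proof.
move=> a0 ab b1; rewrite omega_downE.
rewrite (@eq_up_mass _ _ _ _ _ `[- b, - a[); last first.
  by move=> s _ /=; rewrite !in_itv /= lerNl ltrNr andbC.
rewrite up_mass_itv ?lerN2 ?oppr_le0 //.
rewrite (up_mass_total_variation wN_cont) ?lerN2 ?oppr_le0 //.
rewrite -total_variation_opp /= !opprK; congr (_ + _)%E.
by congr EFin; ring.
Qed.

Lemma omega_up_set1 c : omega_up w [set c] = 0%E.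
Proof. by rewrite omega_upE up_mass_set1. Qed.

Lemma eq_omega_up D D' : (forall s, 0 <= s < 1 -> D s <-> D' s) ->
  omega_up w D = omega_up w D'.
Proof. by move=> DD'; rewrite !omega_upE; exact: eq_up_mass. Qed.

Lemma eq_omega_down D D' : (forall s, 0 < s <= 1 -> D s <-> D' s) ->
  omega_down w D = omega_down w D'.
Proof.
move=> DD'; rewrite !omega_downE; apply: eq_up_mass => s /andP[h1 h2].
by apply: DD'; rewrite oppr_gt0 h2 lerNl.
Qed.

End excursion_measures.

(** * The Lebesgue-Stieltjes measure *)

Section lebesgue_stieltjes.
Context {R : realType} (w : R -> R).
Hypothesis w_cont : {within `[0, 1], continuous w}.
Hypothesis w_bv : bounded_variation 0 1 w.
Variables mu1 mu2 : {measure set (measurableTypeR R) -> \bar R}.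
Hypothesis mu1E : mu1 =1 omega_up w.
Hypothesis mu2E : mu2 =1 omega_down w.
Implicit Types (a b x : R) (X : set (measurableTypeR R)).

Local Notation I01 := (`]0, 1]%classic : set (measurableTypeR R)).

Let tv_fin a b : 0 <= a -> a <= b -> b <= 1 ->
  total_variation a b w \is a fin_num.
Proof.
move=> a0 ab b1; apply/(bounded_variationP w ab).
exact: bounded_variationl ab b1 (bounded_variationr a0 (le_trans ab b1) w_bv).
Qed.

(** The half-open [I01] serves as common carrier of all the measures. Beginnings of excursions lie
    in [0, 1[, but the point 0 has no mass. *)
Let mu1_out X : measurable X -> X `&` I01 = set0 -> mu1 X = 0%E.
Proof.
move=> mX X0; rewrite mu1E (@eq_omega_up _ _ _ (X `&` [set 0])).
  apply/eqP; rewrite -mu1E eq_le measure_ge0 andbT.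
  rewrite -(omega_up_set1 w 0) -mu1E; apply: le_measure; rewrite ?inE //.
  exact: measurableI.
move=> s /andP[s0 s1]; split=> [Xs|[]//]; split => //=.
apply/eqP; rewrite eq_le s0 andbT leNgt; apply/negP => s0'.
have : (X `&` I01) s by split => //=; rewrite in_itv /= s0' ltW.
by rewrite X0.
Qed.

Let mu2_out X : measurable X -> X `&` I01 = set0 -> mu2 X = 0%E.
Proof.
move=> mX X0; rewrite mu2E (@eq_omega_down _ _ _ set0) -?mu2E ?measure0 //.
move=> s s01; split => // Xs.
have : (X `&` I01) s by split => //=; rewrite in_itv.
by rewrite X0.
Qed.

(** The mass is known on [a, b[; points are null, so it is the same on ]a, b]. *)
Let mu1_itv a b : 0 <= a -> a <= b -> b <= 1 ->
  mu1 `]a, b]%classic = ((fine (total_variation a b w) + (w b - w a)) / 2)%:E.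
Proof.
move=> a0 ab b1.
have -> : mu1 `]a, b]%classic = mu1 `[a, b[%classic.
  transitivity (mu1 `[a, b]%classic).
    rewrite -(@setU1itv _ _ (BRight b) a false) ?bnd_simp // setUC measureU0 //.
    by rewrite mu1E; exact: omega_up_set1.
  rewrite -(@setUitv1 _ _ (BLeft a) b true) ?bnd_simp // measureU0 //.
  by rewrite mu1E; exact: omega_up_set1.
have := omega_up_itv w_cont a0 ab b1;
  rewrite -mu1E -(fineK (tv_fin a0 ab b1)) -EFinD.
set c := _ + _; case: (mu1 _) => [r| |]; last 2 first.
- by rewrite gt0_muley ?lte_fin.
- by rewrite gt0_muleNy ?lte_fin.
by rewrite -EFinM => -[<-]; congr EFin; field.
Qed.

Let mu2_itv a b : 0 <= a -> a <= b -> b <= 1 ->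
  mu2 `]a, b]%classic = ((fine (total_variation a b w) - (w b - w a)) / 2)%:E.
Proof.
move=> a0 ab b1.
have := omega_down_itv w_cont a0 ab b1;
  rewrite -mu2E -(fineK (tv_fin a0 ab b1)) -EFinB.
set c := _ - _; case: (mu2 _) => [r| |]; last 2 first.
- by rewrite gt0_muley ?lte_fin.
- by rewrite gt0_muleNy ?lte_fin.
by rewrite -EFinM => -[<-]; congr EFin; field.
Qed.

Let restrict_measure (mu : {measure set (measurableTypeR R) -> \bar R}) X :
  (forall Y, measurable Y -> Y `&` I01 = set0 -> mu Y = 0%E) ->
  measurable X -> mu X = mu (X `&` I01).
Proof.
move=> mu0 mX; have mD : measurable (X `\` I01) by exact: measurableD.
have -> : mu X = (mu (X `\` I01) + mu (X `&` I01))%E by exact: measureDI.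
rewrite (mu0 _ mD) ?add0e //.
by rewrite setDE -setIA setICl setI0.
Qed.

Let mu1T : mu1 setT = ((fine (total_variation 0 1 w) + (w 1 - w 0)) / 2)%:E.
Proof. by rewrite (restrict_measure mu1_out) // setTI mu1_itv. Qed.

Let mu2T : mu2 setT = ((fine (total_variation 0 1 w) - (w 1 - w 0)) / 2)%:E.
Proof. by rewrite (restrict_measure mu2_out) // setTI mu2_itv. Qed.

Variable nu : {charge set (measurableTypeR R) -> \bar R}.
Hypothesis nu_ls : is_lebesgue_stieltjes w nu.
Variables P N : set (measurableTypeR R).
Hypothesis nuPN : hahn_decomposition nu P N.

Let nu_out X : measurable X -> X `&` I01 = set0 -> nu X = 0%E.
Proof.
have [_ nu0 nu_out] := nu_ls; move=> mX X0.
have m0 : measurable ([set 0] : set (measurableTypeR R)) by [].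
rewrite (@charge_partition _ _ _ nu X [set 0] (~` [set 0])) //; last 3 first.
- exact: measurableC.
- by rewrite setUv.
- by rewrite setICr.
rewrite [X in (_ + X)%E]nu_out ?adde0; last 2 first.
- by apply: measurableI => //; exact: measurableC.
- apply/seteqP; split => // s [[Xs /= s0]]; rewrite in_itv /= => /andP[h0 h1].
  have : (X `&` I01) s.
    by split => //=; rewrite in_itv /= h1 andbT lt_neqAle h0 andbT eq_sym;
      exact/eqP.
  by rewrite X0.
have [X0'|X0'] := pselect (X 0).
  by rewrite (_ : X `&` _ = [set 0]) //; apply/seteqP; split => s [] // ->.
rewrite (_ : X `&` _ = set0) ?charge0 //.
by apply/seteqP; split => s // [+ /= s0]; rewrite s0.
Qed.

Let jpos_out X : measurable X -> X `&` I01 = set0 -> jordan_pos nuPN X = 0%E.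
Proof.
move=> mX X0; have mP : measurable P by case: nuPN => -[].
rewrite jordan_posI // nu_out //; first exact: measurableI.
by rewrite setIAC X0 set0I.
Qed.

Let jneg_out X : measurable X -> X `&` I01 = set0 -> jordan_neg nuPN X = 0%E.
Proof.
move=> mX X0; have mN : measurable N by case: nuPN => _ [].
rewrite jordan_negI // nu_out ?oppe0 //; first exact: measurableI.
by rewrite setIAC X0 set0I.
Qed.

Let finJ X : measurable X ->
  jordan_pos nuPN X \is a fin_num /\ jordan_neg nuPN X \is a fin_num.
Proof. by move=> mX; split; apply: fin_num_measure. Qed.

Let nu_itv a b : 0 <= a -> a <= b -> b <= 1 ->
  (jordan_pos nuPN `]a, b]%classic =
    jordan_neg nuPN `]a, b]%classic + (w b - w a)%:E)%E.
Proof.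
move=> a0 ab b1; have [nuI _ _] := nu_ls.
have := nuI a b a0 ab b1; rewrite (jordan_posB nuPN) //.
have mab : measurable (`]a, b]%classic : set (measurableTypeR R)) by [].
have [/fineK <- /fineK <-] := finJ mab.
by rewrite -EFinB -EFinD => -[<-]; congr EFin; ring.
Qed.

(** The uniqueness theorem on half-open intervals concerns measures, so the differences are
    rearranged into sums: [jordan_pos] plus [mu2] against [jordan_neg] plus [mu1]. *)
Lemma stieltjes_excursionE X : measurable X -> nu X = (mu1 X - mu2 X)%E.
Proof.
have fin1 Y : measurable Y -> mu1 Y \is a fin_num.
  move=> mY; rewrite ge0_fin_numE //; apply: (@le_lt_trans _ _ (mu1 setT)).
    by apply: le_measure; rewrite ?inE.
  by rewrite mu1T ltry.
have fin2 Y : measurable Y -> mu2 Y \is a fin_num.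
  move=> mY; rewrite ge0_fin_numE //; apply: (@le_lt_trans _ _ (mu2 setT)).
    by apply: le_measure; rewrite ?inE.
  by rewrite mu2T ltry.
move=> mX; rewrite (jordan_posB nuPN mX).
suff : measure_add (jordan_pos nuPN) mu2 X =
  measure_add (jordan_neg nuPN) mu1 X.
  rewrite !measure_addE /=.
  have [/fineK <- /fineK <-] := finJ mX.
  rewrite -(fineK (fin1 X mX)) -(fineK (fin2 X mX)) -!EFinD => -[h].
  by congr EFin; lra.
apply: (measure_unique (@ocitv R : set (set (measurableTypeR R)))
  (fun n => `](- n%:R), n%:R]%classic)) => //.
- exact: ocitvI.
- by move=> n; exists (- n%:R, n%:R).
- apply/seteqP; split => // x _.
  exists (Num.bound `|x|) => //=; rewrite in_itv /=.
  have hx := archi_boundP (normr_ge0 x).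
  by rewrite ltrNl (le_lt_trans _ hx) ?ler_normr ?lexx ?orbT //= (ltW
    (le_lt_trans (ler_norm x) hx)).
- move=> _ [[a b] _ <-] /=.
  rewrite -[LHS]/(measure_add (jordan_pos nuPN) mu2 _).
  rewrite -[RHS]/(measure_add (jordan_neg nuPN) mu1 _) !measure_addE /=.
  have mab : measurable (`]a, b]%classic : set (measurableTypeR R)) by [].
  rewrite (restrict_measure jpos_out) // (restrict_measure jneg_out) //.
  rewrite (restrict_measure mu1_out) // (restrict_measure mu2_out) //.
  (* All four measures are carried by ]0, 1], so the interval is clipped to it, possibly to
     nothing. *)
  have -> : `]a, b]%classic `&` I01 = `](Num.max a 0), (Num.min b 1)]%classic.
    apply/seteqP; split => x /=; rewrite !in_itv /= gt_max le_min.
      by move=> [/andP[-> ->] /andP[-> ->]].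
    by move=> /andP[/andP[-> ->] /andP[-> ->]].
  have [ab|ba] := leP (Num.max a 0) (Num.min b 1); last first.
    by rewrite set_itv_ge ?measure0 // bnd_simp -leNgt ltW.
  have a0 : 0 <= Num.max a 0 by rewrite le_max lexx orbT.
  have b1 : Num.min b 1 <= 1 by rewrite ge_min lexx orbT.
  rewrite -[LHS]/(jordan_pos nuPN _ + mu2 _)%E.
  rewrite -[RHS]/(jordan_neg nuPN _ + mu1 _)%E nu_itv // mu1_itv //
    mu2_itv // -addeA -EFinD; congr (_ + _%:E)%E.
  by field.
- move=> n; rewrite -[ltLHS]/(measure_add (jordan_pos nuPN) mu2 _).
  rewrite measure_addE lte_add_pinfty //.
    by rewrite ltey_eq (finJ _).1.
  by rewrite ltey_eq fin2.
Qed.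

(** Each increment is the charge of a step, bounded in absolute value by the sum [J] of the two
    Jordan parts; [J] is additive over the steps. *)
Lemma total_variation_le_jordan :
  (total_variation 0 1 w <= jordan_pos nuPN setT + jordan_neg nuPN setT)%E.
Proof.
apply: ge_ereal_sup => _ [_ [s ps <-] <-].
pose J : {measure set (measurableTypeR R) -> \bar R} :=
  measure_add (jordan_pos nuPN) (jordan_neg nuPN).
have JE X : J X = (jordan_pos nuPN X + jordan_neg nuPN X)%E.
  exact: (measure_addE (jordan_pos nuPN) (jordan_neg nuPN)).
suff H a b : 0 <= a -> b <= 1 -> itv_partition a b s ->
    ((variation a b w s)%:E <= J `]a, b]%classic)%E.
  apply: le_trans (H _ _ (lexx 0) (lexx 1) ps) _.
  by rewrite -JE; apply: le_measure; rewrite ?inE.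
move=> + + {}ps; rewrite (variation_zip _ ps).
elim/(@itv_partition_ind R): ps => [{}b _ _|{}a y {}b {}s ay yb ps ih a0 b1].
  by rewrite big_nil measure_ge0.
rewrite /= big_cons /= EFinD.
have -> : `]a, b]%classic =
  (`]a, y] `|` `]y, b])%classic :> set (measurableTypeR R).
  by apply: itv_bndbnd_setU; rewrite bnd_simp // ltW.
rewrite measureU //; last first.
  by apply/seteqP; split => // x [] /=;
    rewrite !in_itv /= => /andP[? ?] /andP[? ?]; lra.
apply: leeD; last by apply: ih => //; lra.
have may : measurable (`]a, y]%classic : set (measurableTypeR R)) by [].
rewrite -[leRHS]/(J _) JE nu_itv ?(ltW ay) //; last by lra.
have /fineK finE := (finJ may).2.
have : (0 <= jordan_neg nuPN `]a, y]%classic)%E by exact: measure_ge0.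
have : (0 <= jordan_pos nuPN `]a, y]%classic)%E by exact: measure_ge0.
rewrite nu_itv ?(ltW ay) //; last by lra.
rewrite -finE -!EFinD !lee_fin => h1 h2.
by case: (ler0P (w y - w a)) => ?; lra.
Qed.

(** The two excursion masses add up to the total variation, which is at most the total Jordan mass;
    [jordan_minimal] then identifies the measures. *)
Lemma excursion_jordan X : measurable X ->
  omega_up w X = jordan_pos nuPN X /\ omega_down w X = jordan_neg nuPN X.
Proof.
move=> mX; rewrite -mu1E -mu2E; apply: jordan_minimal mX.
- by rewrite mu1T ltry.
- by rewrite mu2T ltry.
- exact: stieltjes_excursionE.
apply: le_trans total_variation_le_jordan.
rewrite mu1T mu2T -EFinD -(fineK (tv_fin _ _ _)) // lee_fin.
by lra.
Qed.

End lebesgue_stieltjes.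

(** * Finiteness criteria and the total variation formula *)

(** Each of the three masses is tied to the total variation [y] by such an identity, with [c] a
    boundary term. *)
Lemma lt_pinfty_double {R : realType} (x y : \bar R) (c : R) :
  (0 <= y)%E -> (2%:E * x = y + c%:E)%E -> (x < +oo)%E <-> y \is a fin_num.
Proof.
move=> y0; case: x => [r| |]; case: y y0 => [s| |] // _;
  by rewrite ?ltry ?gt0_muley ?gt0_muleNy ?lte_fin.
Qed.

Theorem proposition2p3 (R : realType) (w : R -> R)
    (w_cont : {within `[0, 1], continuous w})
    (w_nonconst : exists s t, [/\ s \in `[0, 1], t \in `[0, 1] & w s <> w t])
    (U : time R) (U_min : forall t, t \in `[0, 1] -> w (val U) <= w t)
    (lambda : {measure set (borel_tree w_cont) -> \bar R})
    (lambda_length : is_length_measure (tree_pi w_cont U) lambda) :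
  [/\ [/\ (lambda setT < +oo)%E <-> bounded_variation 0 1 w,
          (omega_up w `[0%R, 1%R] < +oo)%E <-> bounded_variation 0 1 w &
          (omega_down w `[0%R, 1%R] < +oo)%E <-> bounded_variation 0 1 w],
      bounded_variation 0 1 w ->
        forall nu : {charge set (measurableTypeR R) -> \bar R},
        is_lebesgue_stieltjes w nu ->
        forall (P N : set (measurableTypeR R))
          (nuPN : hahn_decomposition nu P N) (A : set (measurableTypeR R)),
        measurable A ->
        omega_up w A = jordan_pos nuPN A /\ omega_down w A = jordan_neg nuPN A &
      total_variation 0 1 w =
        (2%:E * lambda [set: borel_tree w_cont] - (tree_delta w 0 1)%:E)%E].
Proof.
have tv0 := total_variation_ge0 w (@ler01 R).
(* Beginnings of excursions lie in [0, 1[ and ends in ]0, 1], so closing the interval adds no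
   mass. *)
have up01 : (2%:E * omega_up w `[0%R, 1%R] =
    total_variation 0 1 w + (w 1 - w 0)%:E)%E.
  rewrite -(omega_up_itv w_cont (lexx 0) ler01 (lexx 1)).
  rewrite (@eq_omega_up _ _ _ `[0, 1[) //.
  by move=> s s01 /=; rewrite !in_itv /= s01; case/andP: s01 => -> /ltW ->.
have down01 : (2%:E * omega_down w `[0%R, 1%R] =
    total_variation 0 1 w + (- (w 1 - w 0))%:E)%E.
  transitivity (2%:E * omega_down w `]0%R, 1%R])%E.
    rewrite (@eq_omega_down _ _ _ `]0, 1]) // => s s01.
    by rewrite /= !in_itv /= s01; case/andP: s01 => /ltW -> ->.
  exact: (omega_down_itv w_cont (lexx 0) ler01 (lexx 1)).
have delta01 : tree_delta w 0 1 = w 0 + w 1 - 2 * w (val U).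
  congr (_ - _ * _); apply/eqP; rewrite eq_le -/(pinf w 0 1).
  have U01 : 0 <= val U <= 1 by have := valP U; rewrite in_itv.
  rewrite (pinf_le w_cont) ?lexx ?ler01 ?(min_l ler01) ?(max_r ler01) //=.
  by apply: (le_pinf_le ler01) => u u01; apply: U_min; rewrite in_itv.
(* Doubling [lambda_tree] leaves the constant [2 * (w 0 - w (val U)) + (w 1 - w 0)], which is
   [tree_delta w 0 1]. *)
have lambda01 : (2%:E * lambda setT =
    total_variation 0 1 w + (tree_delta w 0 1)%:E)%E.
  have := up_mass_total_variation w_cont (lexx 0) ler01 (lexx 1).
  rewrite (lambda_tree U_min lambda_length); move: (up_mass _ _ _ _) => u uE.
  rewrite muleDr ?fin_num_adde_defr // uE.
  rewrite addeCA -EFinM -EFinD; congr (_ + _%:E)%E.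
  by rewrite delta01; ring.
split.
- by split; rewrite (bounded_variationP w ler01);
    [exact: lt_pinfty_double lambda01|exact: lt_pinfty_double up01|
     exact: lt_pinfty_double down01].
- move=> w_bv nu nu_ls P N nuPN A mA.
  have [mu1 mu1E] := omega_up_measure w_cont.
  have [mu2 mu2E] := omega_down_measure w_cont.
  exact: (excursion_jordan w_cont w_bv mu1E mu2E nu_ls nuPN mA).
by rewrite lambda01 addeK.
Qed.
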